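(* Let $\mathcal{C}$ be an effectively compact class of probability measures on a constructive metric space $X$. If there exists a lower semicontinuous separator $s(x,P)$ for $\mathcal{C}$, then $\mathcal{C}$ is effectively orthogonal.
   Context: A constructive metric space $(X,d,D,\alpha)$ is a complete separable metric space with a numbered dense countable set $D$ on which $d$ is uniformly computable; basic balls have centres in $D$ and rational radii. $\mathcal{M}(X)$ (probability measures, Prokhorov metric, dense set of rational finitely supported measures on $D$) is a constructive metric space. A subset $\mathcal{C}$ of it is effectively compact if it is compact and the set of finite coverings of $\mathcal{C}$ by basic balls is enumerable. A function $f:X\times\mathcal{M}(X)\to[0,\infty]$ is lower semicomputable if each $\{f>r\}$ ($r$ rational) is a union of an enumerable family of products of basic balls, uniformly in $r$. A uniform test is such $f$ with $\int f(x,P)\,dP(x)\le1$ for all $P$; with $\mathbf{t}$ a universal (maximal up to a constant factor) uniform test, $\mathrm{Randoms}(P)=\{x:\mathbf{t}(x,P)<\infty\}$; $\mathcal{C}$ is effectively orthogonal if $\mathrm{Randoms}(P)\cap\mathrm{Randoms}(Q)=\varnothing$ for distinct $P,Q\in\mathcal{C}$. A separator for $\mathcal{C}$ is a measurable $s:X\times\mathcal{M}(X)\to[0,\infty]$ with $\int s(x,P)\,dP(x)\le1$ for every $P$ and such that for all distinct $P,Q\in\mathcal{C}$ and every $x$ at least one of $s(x,P),s(x,Q)$ is infinite. *)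

(* Defs.v *)
From HB Require Import structures.
From mathcomp Require Import all_boot all_order all_algebra.
From mathcomp Require Import all_classical all_reals all_analysis.
From mathcomp Require Import measurable_realfun.
From mathcomp Require Import giry.

Set Implicit Arguments.
Unset Strict Implicit.
Unset Printing Implicit Defensive.

Import Order.TTheory GRing.Theory Num.Theory.
Import numFieldNormedType.Exports.

Local Open Scope classical_set_scope.
Local Open Scope ring_scope.

(** Kleene's general recursive (i.e. total computable) functions: minimization
    is only applied where the search always succeeds, so that every function in
    the class is total. *)
Inductive recursive : forall n : nat, (n.-tuple nat -> nat) -> Prop :=
| recursive_zero n : recursive (fun _ : n.-tuple nat => 0%N)
| recursive_succ : recursive (fun t : 1.-tuple nat => (thead t).+1)
| recursive_proj n (i : 'I_n) : recursive (fun t : n.-tuple nat => tnth t i)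
| recursive_comp m n (f : m.-tuple nat -> nat) (g : 'I_m -> n.-tuple nat -> nat) :
    recursive f -> (forall i, recursive (g i)) ->
    recursive (fun t : n.-tuple nat => f [tuple g i t | i < m])
| recursive_primrec n (f : n.-tuple nat -> nat) (g : n.+2.-tuple nat -> nat) :
    recursive f -> recursive g ->
    recursive (fun t : n.+1.-tuple nat =>
      iteri (thead t) (fun k r => g [tuple of k :: r :: behead t])
            (f [tuple of behead t]))
| recursive_min n (f : n.+1.-tuple nat -> nat) (g : n.-tuple nat -> nat) :
    recursive f ->
    (forall t, f [tuple of g t :: t] = 0%N /\
               forall k, (k < g t)%N -> f [tuple of k :: t] <> 0%N) ->
    recursive g.

Definition enumerable (W : set nat) : Prop :=
  W = set0 \/
  exists f : 1.-tuple nat -> nat,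
    recursive f /\ W = range (fun n : nat => f [tuple n]).

(** Finite sequences of naturals are numbered by the bijection
    [CodeSeq.code] / [CodeSeq.decode]; [entry n i] is the [i]-th entry of the
    sequence numbered [n], padded with zeros. *)
Definition entry (n i : nat) : nat := nth 0%N (CodeSeq.decode n) i.

(** Numberings of the rationals and of the positive rationals (as reals). *)
Definition rational {R : realType} (n : nat) : R :=
  ((entry n 0)%:R - (entry n 1)%:R) / (entry n 2).+1%:R.

Definition pos_rational {R : realType} (n : nat) : R :=
  (entry n 0).+1%:R / (entry n 1).+1%:R.

#[short(type="completeMetricType")]
HB.structure Definition CompleteMetric (R : realType) :=
  {T of Metric R T & Complete T}.

(** The dense set [D] is [range alpha]. *)
Definition constructive_metric {R : realType} {X : completeMetricType R}
    (alpha : nat -> X) : Prop :=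
  dense (range alpha) /\
  exists f : 3.-tuple nat -> nat, recursive f /\
    forall i j k : nat,
      `|mdist (alpha i) (alpha j) - rational (f [tuple i; j; k])| <= 2^-1 ^+ k.

Definition basic_ball {R : realType} {T : pseudoMetricType R}
    (alpha : nat -> T) (n : nat) : set T :=
  ball (alpha (entry n 0)) (pos_rational (entry n 1)).

Definition effectively_compact {R : realType} {T : pseudoMetricType R}
    (alpha : nat -> T) (C : set T) : Prop :=
  compact C /\
  enumerable [set n | C `<=`
    \bigcup_(b in [set` CodeSeq.decode n]) basic_ball alpha b].

(** Uniformity in [r]: a single enumerable set [W] serves all rationals. *)
Definition lower_semicomputable {R : realType} {T U : pseudoMetricType R}
    (alpha : nat -> T) (beta : nat -> U) (f : T * U -> \bar R) : Prop :=
  exists W : set nat, enumerable W /\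
    forall k : nat, [set z | ((rational k)%:E < f z)%E] =
      \bigcup_(c in [set c : nat * nat | W (CodeSeq.code [:: k; c.1; c.2])])
        (basic_ball alpha c.1 `*` basic_ball beta c.2).

Definition borel (T : topologicalType) := g_sigma_algebraType (@open T).

(** A library measure is defined on all sets, its values outside the
    sigma-algebra being irrelevant.  Hence two elements of [M X] are the same
    measure when they are related by [≡μ], not by [=], and the Prokhorov
    distance makes [M X] a pseudometric space. *)
Definition M {R : realType} (X : completeMetricType R) : Type :=
  probability (borel X) R.

Section prokhorov.
Context {R : realType} {X : completeMetricType R}.
Implicit Types P Q : M X.

Definition enlarge (A : set X) (e : R) : set X :=
  [set x | exists2 y, A y & mdist y x < e].

Definition prokhorov_bound P Q : set R :=
  [set e | 0 < e /\ forall A : set (borel X), measurable A ->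
    (P A <= Q (enlarge A e) + e%:E)%E /\ (Q A <= P (enlarge A e) + e%:E)%E].

Definition prokhorov P Q : R := inf (prokhorov_bound P Q).

Lemma enlarge_open (A : set X) (e : R) : open (enlarge A e).
Proof.
have -> : enlarge A e = \bigcup_(y in A) ball y e.
  by apply/seteqP; split=> x [y Ay yx]; exists y => //; move: yx; rewrite ballEmdist.
apply: bigcup_open => y _; rewrite openE => x; rewrite ballEmdist /= => yx.
rewrite /interior -nbhs_ballE; exists (e - mdist y x) => /=; first by rewrite subr_gt0.
move=> z; rewrite !ballEmdist /= => xz.
by rewrite (le_lt_trans (metric_triangle _ x _))// -ltrBrDl.
Qed.

Lemma enlarge_measurable (A : set X) (e : R) :
  measurable (enlarge A e : set (borel X)).
Proof. by apply: sub_sigma_algebra; exact: enlarge_open. Qed.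

Lemma prokhorov_has_inf P Q : has_inf (prokhorov_bound P Q).
Proof.
split; last by exists 0 => e [/ltW].
exists 1; split=> // A mA.
by split; (apply: le_trans (probability_le1 _ mA) _);
  rewrite leeDr// measure_ge0.
Qed.

Lemma prokhorov_xx P : prokhorov P P <= 0.
Proof.
apply/ler_addgt0Pl => e e0; rewrite addr0; apply: ge_inf.
  by case: (prokhorov_has_inf P P).
split=> // A mA.
have AA : A `<=` enlarge A e by move=> x Ax; exists x; rewrite // mdistxx.
have le_PA : (P A <= P (enlarge A e) + e%:E)%E.
  apply: (@le_trans _ _ (P (enlarge A e))).
    by apply: le_measure; rewrite ?inE //; exact: enlarge_measurable.
  by rewrite leeDl// lee_fin ltW.
by split.
Qed.

Lemma prokhorov_sym P Q : prokhorov P Q = prokhorov Q P.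
Proof.
congr inf; apply/seteqP.
by split=> e [e0 H]; split=> // A /H[? ?].
Qed.

Lemma prokhorov_triangle P Q S :
  prokhorov P S <= prokhorov P Q + prokhorov Q S.
Proof.
apply/ler_addgt0Pr => e e0.
have e20 : 0 < e / 2 by rewrite divr_gt0.
have [a [a0 Ha] a_lt] := inf_adherent e20 (prokhorov_has_inf P Q).
have [b [b0 Hb] b_lt] := inf_adherent e20 (prokhorov_has_inf Q S).
apply: (@le_trans _ _ (a + b)); last first.
  by rewrite [e]splitr addrACA lerD ?ltW.
apply: ge_inf; first by case: (prokhorov_has_inf P S).
split=> [|A mA]; first exact: addr_gt0.
have sub u v : enlarge (enlarge A u) v `<=` enlarge A (u + v).
  move=> x [y [z Az zy] yx]; exists z => //.
  by rewrite (le_lt_trans (metric_triangle _ y _))// ltrD.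
have step (T U V : M X) u v :
    (T A <= U (enlarge A u) + u%:E)%E ->
    (U (enlarge A u) <= V (enlarge (enlarge A u) v) + v%:E)%E ->
    (T A <= V (enlarge A (u + v)) + (u + v)%:E)%E.
  move=> TU UV; apply: (le_trans TU).
  rewrite [X in (_ <= _ + X)%E](_ : _ = v%:E + u%:E)%E; last by rewrite addeC.
  rewrite addeA; apply: leeD => //.
  apply: (le_trans UV); apply: leeD => //.
  apply: le_measure; rewrite ?inE; [exact: enlarge_measurable..|exact: sub].
have [TU _] := Ha _ mA; have [UV _] := Hb _ (enlarge_measurable A a).
have [_ SU] := Hb _ mA; have [_ UP] := Ha _ (enlarge_measurable A b).
split; first exact: step TU UV.
by rewrite [(a + b)%R]addrC; exact: step SU UP.
Qed.

Lemma prokhorov_ball_center P (e : R) : 0 < e -> prokhorov P P < e.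
Proof. exact/le_lt_trans/prokhorov_xx. Qed.

Lemma prokhorov_ball_triangle P Q S (a b : R) :
  prokhorov P Q < a -> prokhorov Q S < b -> prokhorov P S < a + b.
Proof.
by move=> PQ QS; rewrite (le_lt_trans (prokhorov_triangle P Q S))// ltrD.
Qed.

Let prokhorov_ball P (e : R) : set (M X) := [set Q | prokhorov P Q < e].

Let prokhorov_ball_sym P Q (e : R) : prokhorov_ball P e Q -> prokhorov_ball Q e P.
Proof. by rewrite /prokhorov_ball/= prokhorov_sym. Qed.

HB.instance Definition _ := Choice.on (M X).
HB.instance Definition _ := Pointed.on (M X).
HB.instance Definition _ :=
  hasNbhs.Build (M X) (nbhs_ (entourage_ prokhorov_ball)).
HB.instance Definition _ := @Nbhs_isPseudoMetric.Build R (M X)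
  (entourage_ prokhorov_ball) erefl prokhorov_ball prokhorov_ball_center
  prokhorov_ball_sym prokhorov_ball_triangle erefl.

Lemma ball_prokhorovE P (e : R) : ball P e = [set Q | prokhorov P Q < e].
Proof. by []. Qed.

End prokhorov.

(** The sequence numbered [n] lists numbers of pairs (index of a point of [D],
    natural weight).  Normalizing the total weight gives exactly the finitely
    supported probability measures on [D] with rational weights (a null total
    weight stands for the point mass at [alpha 0]). *)
Definition rational_measure {R : realType} {X : completeMetricType R}
    (alpha : nat -> X) (n : nat) : M X :=
  let s := CodeSeq.decode n in
  mnormalize
    (msum (fun k => mscale (entry (nth 0%N s k) 1)%:R%:nng
                      (@dirac _ (borel X) (alpha (entry (nth 0%N s k) 0)) R))
          (size s))
    (@dirac _ (borel X) (alpha 0%N) R).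

Section randomness.
Context {R : realType} {X : completeMetricType R}.
Variable alpha : nat -> X.
Implicit Types (f s t : X * M X -> \bar R) (P Q : M X) (C : set (M X)).
Local Open Scope ereal_scope.

Definition normalized f : Prop :=
  forall P, \int[P]_(x in [set: borel X]) f (x, P) <= 1.

Definition uniform_test f : Prop :=
  [/\ forall z, 0 <= f z,
      lower_semicomputable alpha (rational_measure alpha) f &
      normalized f].

Definition universal_test t : Prop :=
  uniform_test t /\
  forall f, uniform_test f ->
    exists2 c : R, (0 < c)%R & forall z, f z <= c%:E * t z.

Definition Randoms t P : set X := [set x | t (x, P) < +oo].

(** [Randoms t P] does not depend on the choice of the universal test [t]. *)
Definition effectively_orthogonal C : Prop :=
  forall t, universal_test t ->
    forall P Q, C P -> C Q -> ~ (P ≡μ Q) ->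
      Randoms t P `&` Randoms t Q = set0.

Definition separator C s : Prop :=
  [/\ forall z, 0 <= s z,
      measurable_fun [set: borel (X * M X)%type] s,
      normalized s &
      forall P Q, C P -> C Q -> ~ (P ≡μ Q) ->
        forall x, s (x, P) = +oo \/ s (x, Q) = +oo].

End randomness.

(* Main.v *)
(** The proof is a search for tests. Let [P] and [Q] be distinct members of [C].
    Cover [C] by finitely many small basic balls, and let [C1] (resp. [C2])
    be [C] minus the balls of the cover that do not contain [P] (resp. [Q]);
    these are disjoint compact sets. For a lower semicontinuous separator
    [s], the set of the [x] with [s(x, .) > a] on [C1] and its analogue for
    [C2] are open, cover [X], and have small measure under the members of
    [C1], resp. [C2]. Approximating them from inside gives finite unions of
    basic balls [U] and [V] that are formally disjoint, with [P' V > 1 -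
    4^-n] on [C1] and [Q' U > 1 - 4^-n] on [C2]. These inequalities hold on
    neighbourhoods of measures of finite support, where they can be
    verified, so effective compactness of [C] makes such pairs [(U_n, V_n)]
    searchable by a recursive function of [n]. The supremum of the [n] for
    which [x] lies in a basic ball formally disjoint from [V_n] is then a
    test for measures near [C1], and likewise with [U_n] and [C2]; since
    every [x] is away from [U_n] or from [V_n], one of the two tests is
    infinite at [x]. *)

Require Import Defs.
From HB Require Import structures.
From mathcomp Require Import all_boot all_order all_algebra.
From mathcomp Require Import all_classical all_reals all_analysis.
From mathcomp Require Import measurable_realfun.
From mathcomp Require Import giry.
From mathcomp Require Import zify ring lra.

Set Implicit Arguments.
Unset Strict Implicit.
Unset Printing Implicit Defensive.

Import Order.TTheory GRing.Theory Num.Theory.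
Import numFieldNormedType.Exports.

Local Open Scope classical_set_scope.
Local Open Scope ring_scope.

(** * Recursive functions *)

Section computable.
Local Open Scope nat_scope.
Implicit Types (f g h : seq nat -> nat) (s : seq nat).

(* The function is read off lists of every length at once: missing arguments
   are zero, as in [nth 0 s i], so that no arity has to be tracked. *)
Definition computable f : Prop :=
  forall n, recursive (fun t : n.-tuple nat => f t).

Definition computable1 (F : nat -> nat) :=
  computable (fun s => F (nth 0 s 0)).
Definition computable3 (F : nat -> nat -> nat -> nat) :=
  computable (fun s => F (nth 0 s 0) (nth 0 s 1) (nth 0 s 2)).

Lemma eq_computable f g : f =1 g -> computable f -> computable g.
Proof. by move=> /funext->. Qed.

(** * Composition and rearrangement of arguments *)

Lemma recursive_comp_seq n (F : seq nat -> nat) (gs : seq (seq nat -> nat)) :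
  recursive (fun t : (size gs).-tuple nat => F t) ->
  (forall i, computable (nth (fun=> 0) gs i)) ->
  recursive (fun t : n.-tuple nat => F [seq g t | g <- gs]).
Proof.
move=> rF rg.
have := @recursive_comp _ n _ (fun i t => nth (fun=> 0) gs (nat_of_ord i) t) rF
  (fun i => rg i n).
congr recursive; apply/funext => t /=; congr F.
rewrite -[in RHS](mkseq_nth (fun=> 0) gs) /mkseq -map_comp /=.
by rewrite -val_enum_ord -map_comp.
Qed.

Lemma computable_comp F (gs : seq (seq nat -> nat)) :
  computable F -> (forall i, computable (nth (fun=> 0) gs i)) ->
  computable (fun s => F [seq g s | g <- gs]).
Proof. by move=> rF rg n; exact: recursive_comp_seq. Qed.

Lemma computable_zero : computable (fun=> 0).
Proof. by move=> n; exact: recursive_zero. Qed.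

Lemma computable_nth i : computable (fun s => nth 0 s i).
Proof.
move=> n; case: (ltnP i n) => [lin|leni].
  have := recursive_proj (Ordinal lin); congr recursive.
  by apply/funext => t; rewrite (tnth_nth 0).
have := recursive_zero n; congr recursive.
by apply/funext => t; rewrite nth_default ?size_tuple.
Qed.

Lemma computable_app1 F f :
  computable1 F -> computable f -> computable (fun s => F (f s)).
Proof.
move=> rF rf; apply: (computable_comp (gs := [:: f]) rF) => -[|[|i]] //=;
  exact: computable_zero.
Qed.

Lemma computable_app3 F f g h :
  computable3 F -> computable f -> computable g -> computable h ->
  computable (fun s => F (f s) (g s) (h s)).
Proof.
move=> rF rf rg rh.
apply: (computable_comp (gs := [:: f; g; h]) rF) => -[|[|[|[|i]]]] //=;
  exact: computable_zero.
Qed.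

Lemma computable_succ f : computable f -> computable (fun s => (f s).+1).
Proof.
move=> rf n.
have rs : recursive (fun t : (size [:: f]).-tuple nat => (nth 0 t 0).+1).
  have := recursive_succ; congr recursive.
  by apply/funext => t; rewrite /thead (tnth_nth 0).
apply: (@recursive_comp_seq n (fun s => (nth 0 s 0).+1) [:: f] rs) => -[|[|i]] //=;
  exact: computable_zero.
Qed.

Lemma computable_const c : computable (fun=> c).
Proof. by elim: c => [|c]; [exact: computable_zero|exact: computable_succ]. Qed.

(** Recursiveness is tested at one arity at a time, so the list of selected positions may depend on
    the length of the argument. *)
Lemma computable_reindex f (l : nat -> seq nat) : computable f ->
  computable (fun s => f [seq nth 0 s i | i <- l (size s)]).
Proof.
move=> rf n; pose gs := [seq (fun s => nth 0 s i) | i <- l n].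
have rg i : computable (nth (fun=> 0) gs i).
  case: (ltnP i (size (l n))) => il; last first.
    by rewrite nth_default ?size_map//; exact: computable_zero.
  by rewrite (nth_map 0)//; exact: computable_nth.
have := recursive_comp_seq n (rf _) rg; congr recursive.
by apply/funext => t; rewrite size_tuple -map_comp.
Qed.

Lemma computable_behead f : computable f -> computable (fun s => f (behead s)).
Proof.
move=> rf.
apply: eq_computable (computable_reindex (fun n => iota 1 n.-1) rf) => s.
congr f; case: s => [|x s] //=.
by rewrite -[1]/(1 + 0) iotaDl -map_comp /= -[RHS](mkseq_nth 0).
Qed.

(** In a primitive recursion the step sees the counter and the accumulator in front of the
    parameters; this discards the accumulator. *)
Lemma computable_drop1 f : computable f ->
  computable (fun s => f (nth 0 s 0 :: behead (behead s))).
Proof.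
move=> rf.
apply: eq_computable (computable_reindex (fun n => 0 :: iota 2 n.-2) rf) => s.
congr f; case: s => [|x [|y s]] //=; congr (_ :: _).
by rewrite -[2]/(2 + 0) iotaDl -map_comp /= -[RHS](mkseq_nth 0).
Qed.

(** * Primitive recursion and arithmetic *)

Lemma computable_iteri (G : seq nat -> nat -> nat -> nat) h f :
  computable h -> computable f ->
  computable (fun s => G (behead (behead s)) (nth 0 s 0) (nth 0 s 1)) ->
  computable (fun s => iteri (h s) (G s) (f s)).
Proof.
move=> rh rf rG n.
(* Primitive recursion reads the number of iterations from its first argument, so [h t] is put in
   front of [t]. *)
pose ph (i : 'I_n.+1) (t : n.-tuple nat) :=
  if unlift ord0 i is Some j then tnth t j else h t.
have rph i : recursive (ph i).
  rewrite /ph; case: unliftP => [j _|_]; last exact: rh.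
  exact: recursive_proj.
have := recursive_comp (recursive_primrec (rf n) (rG n.+2)) rph.
congr recursive; apply/funext => t.
have -> : [tuple ph i t  | i < n.+1] = [tuple of h t :: t].
  apply: eq_from_tnth => i; rewrite tnth_mktuple /ph.
  by case: unliftP => [j|] ->; rewrite ?tnthS ?tnth0.
by rewrite theadE.
Qed.

Lemma computable_iter1 (G : nat -> nat) h f :
  computable1 G -> computable h -> computable f ->
  computable (fun s => iter (h s) G (f s)).
Proof.
move=> rG rh rf.
have := computable_iteri (G := fun _ _ r => G r) rh rf
  (computable_app1 rG (computable_nth 1)).
by apply: eq_computable => s; elim: (h s) => //= n ->.
Qed.

Lemma computable_pred f : computable f -> computable (fun s => (f s).-1).
Proof.
apply: (@computable_app1 predn).
(* The predecessor is the last value taken by the counter of an iteration. *)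
apply: eq_computable
  (computable_iteri (G := fun _ k _ => k) (computable_nth 0) computable_zero
  (computable_nth 0)) => s.
by case: (nth _ _ _).
Qed.

Lemma computable_add f g :
  computable f -> computable g -> computable (fun s => f s + g s).
Proof.
move=> rf rg; apply: eq_computable (computable_iter1 _ rg rf) => [s|].
  exact: iter_succn.
exact: computable_succ (computable_nth 0).
Qed.

Lemma computable_sub f g :
  computable f -> computable g -> computable (fun s => f s - g s).
Proof.
move=> rf rg; apply: eq_computable (computable_iter1 (G := predn) _ rg rf) => [s|].
  by elim: (g s) => [|n /= ->]; rewrite ?subn0 ?subnS.
exact: computable_pred (computable_nth 0).
Qed.

Lemma computable_subst_head f g : computable f -> computable g ->
  computable (fun s => f (g s :: behead s)).
Proof.
move=> rf rg n.
pose gs := g :: [seq (fun s => nth 0 s i) | i <- iota 1 n.-1].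
have rgs i : computable (nth (fun=> 0) gs i).
  case: i => [|i] //=; case: (ltnP i n.-1) => iN; last first.
    by rewrite nth_default ?size_map ?size_iota//; exact: computable_zero.
  by rewrite (nth_map 0) ?size_iota//; exact: computable_nth.
have := recursive_comp_seq n (rf _) rgs; congr recursive.
apply/funext => t; rewrite /= -map_comp; congr f; congr (_ :: _).
rewrite -[1]/(1 + 0) iotaDl -map_comp -[RHS](mkseq_nth 0) size_behead size_tuple.
by apply: eq_map => i /=; rewrite nth_behead.
Qed.

Lemma computable_sum (G : seq nat -> nat -> nat) h :
  computable h -> computable (fun s => G (behead s) (nth 0 s 0)) ->
  computable (fun s => \sum_(k < h s) G s k).
Proof.
move=> rh rG.
have := computable_iteri (G := fun s k r => r + G s k) rh computable_zero.
move=> /(_ _)/eq_computable; apply.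
  by move=> s; elim: (h s) => [|n /= ->]; rewrite (big_ord0, big_ord_recr).
apply: computable_add; first exact: computable_nth.
exact: computable_drop1 rG.
Qed.
Lemma computable_mul f g :
  computable f -> computable g -> computable (fun s => f s * g s).
Proof.
move=> rf rg.
have := computable_sum (G := fun s _ => g s) rf (computable_behead rg).
by apply: eq_computable => s; rewrite sum_nat_const card_ord.
Qed.

Lemma computable_exp f g :
  computable f -> computable g -> computable (fun s => f s ^ g s).
Proof.
move=> rf rg.
have := computable_iteri (G := fun s _ r => f s * r) rg (computable_const 1).
move=> /(_ _)/eq_computable; apply.
  by move=> s; elim: (g s) => [|n /= ->]; rewrite (expn0, expnS).
apply: computable_mul (computable_nth 1).
exact: (computable_behead (computable_behead rf)).
Qed.

(** * Boolean operations, comparison and division *)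

Lemma computable_not (b : seq nat -> bool) : computable b ->
  computable (fun s => ~~ b s).
Proof.
move=> rb; apply: eq_computable (computable_sub (computable_const 1) rb) => s.
by case: (b s).
Qed.

Lemma computable_and (b c : seq nat -> bool) : computable b -> computable c ->
  computable (fun s => b s && c s).
Proof.
move=> rb rc; apply: eq_computable (computable_mul rb rc) => s.
by case: (b s); case: (c s).
Qed.

Lemma computable_or (b c : seq nat -> bool) : computable b -> computable c ->
  computable (fun s => b s || c s).
Proof.
move=> rb rc; apply: eq_computable (computable_not
  (computable_and (computable_not rb) (computable_not rc))) => s.
by rewrite negb_and !negbK.
Qed.

Lemma computable_eq0 f : computable f -> computable (fun s => f s == 0).
Proof.
move=> rf; apply: eq_computable (computable_sub (computable_const 1) rf) => s.
by case: (f s).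
Qed.

Lemma computable_leq f g :
  computable f -> computable g -> computable (fun s => f s <= g s).
Proof. by move=> rf rg; exact: computable_eq0 (computable_sub rf rg). Qed.

Lemma computable_ltn f g :
  computable f -> computable g -> computable (fun s => f s < g s).
Proof. by move=> rf rg; apply: computable_leq rg; exact: computable_succ. Qed.

Lemma computable_eqn f g :
  computable f -> computable g -> computable (fun s => f s == g s).
Proof.
move=> rf rg; apply: eq_computable
  (computable_and (computable_leq rf rg) (computable_leq rg rf)) => s.
by rewrite eqn_leq.
Qed.

Lemma computable_if (b : seq nat -> bool) f g :
  computable b -> computable f -> computable g ->
  computable (fun s => if b s then f s else g s).
Proof.
move=> rb rf rg; apply: eq_computable (computable_add (computable_mul rb rf)
  (computable_mul (computable_not rb) rg)) => s.
by case: (b s); rewrite /= ?mul1n ?mul0n ?addn0.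
Qed.

Lemma sum_ltn m q : \sum_(k < m) (k < q : nat) = minn m q.
Proof.
elim: m => [|m IH]; first by rewrite big_ord0 min0n.
by rewrite big_ord_recr /= IH; lia.
Qed.

(** The quotient is the number of positive multiples of the divisor up to [f s]. The divisor is
    written as a successor to be nonzero. *)
Lemma computable_divn f g : computable f -> computable g ->
  computable (fun s => f s %/ (g s).+1).
Proof.
move=> rf rg.
have := computable_sum (G := fun s k => (k.+1 * (g s).+1 <= f s) : nat) rf.
move=> /(_ _)/eq_computable; apply.
  move=> s; set d := (g s).+1; set m := f s.
  have -> : \sum_(k < m) (k.+1 * d <= m : nat) = \sum_(k < m) (k < m %/ d : nat).
    by apply: eq_bigr => k _; rewrite leq_divRL.
  by rewrite sum_ltn (minn_idPr (leq_div m d)).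
have rb h : computable h -> computable (fun s => h (behead s)).
  exact: computable_behead.
apply: computable_leq (rb _ rf).
by apply: computable_mul; apply: computable_succ; [exact: computable_nth|exact: rb].
Qed.

Lemma computable_dvdn f g : computable f -> computable g ->
  computable (fun s => (g s).+1 %| f s).
Proof.
move=> rf rg; apply: eq_computable (computable_eqn
  (computable_mul (computable_divn rf rg) (computable_succ rg)) rf) => s.
by rewrite dvdn_eq.
Qed.

(** * The 2-adic valuation and codes of finite sequences *)

Lemma computable_logn2 : computable1 (logn 2).
Proof.
have r0 := computable_nth 0.
have := computable_sum (G := fun s k => (2 ^ k.+1).-1.+1 %| nth 0 s 0 : nat) r0.
move=> /(_ _)/eq_computable; apply.
  move=> s; case: (nth 0 s 0) => [|n]; first by rewrite big_ord0 logn0.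
  rewrite logn_count_dvd// big_add1 big_mkord big_ord_recr /=.
  (* The computed sum has one term more than the formula for the valuation; it vanishes because
     2^(n+1) exceeds n + 1. *)
  rewrite [X in _ + X](_ : _ = 0) ?addn0.
    by apply: eq_bigr => k _; rewrite prednK// expn_gt0.
  rewrite prednK ?expn_gt0// gtnNdvd//.
  by rewrite (@leq_trans (2 ^ n.+1)) ?leq_pexp2l// ltn_expl.
apply: computable_dvdn; first exact: (computable_behead r0).
apply: computable_pred; apply: computable_exp; first exact: computable_const.
exact: computable_succ.
Qed.

(** The code of [a :: s] is 2^a (2c + 1), with c the code of [s]. Hence the 2-adic valuation reads
    off the head, and the rounded division by 2^(a+1) leaves c. *)
Definition code_tail x := x %/ 2 ^ (logn 2 x).+1.

Lemma computable_code_tail : computable1 code_tail.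
Proof.
have r0 := computable_nth 0.
have := computable_divn (g := fun s => (2 ^ (logn 2 (nth 0 s 0)).+1).-1) r0.
move=> /(_ _)/eq_computable; apply.
  by move=> s; rewrite prednK ?expn_gt0.
apply: computable_pred; apply: computable_exp; first exact: computable_const.
apply: computable_succ; exact: computable_logn2.
Qed.

Lemma logn2_code a s : logn 2 (CodeSeq.code (a :: s)) = a.
Proof.
rewrite /= lognM ?expn_gt0// pfactorK// logn_coprime ?addn0//.
by rewrite coprime2n /= odd_double.
Qed.

Lemma code_tail_code s : code_tail (CodeSeq.code s) = CodeSeq.code (behead s).
Proof.
case: s => [|a s]; first by rewrite /code_tail div0n.
rewrite /code_tail logn2_code /= expnSr divnMA mulKn ?expn_gt0//.
by rewrite -addn1 -muln2 divnMDl// addn0.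
Qed.

Lemma iter_code_tail i s :
  iter i code_tail (CodeSeq.code s) = CodeSeq.code (drop i s).
Proof.
elim: i => [|i IH] /=; first by rewrite drop0.
by rewrite IH code_tail_code -drop1 drop_drop add1n.
Qed.

Lemma computable_entry f g : computable f -> computable g ->
  computable (fun s => entry (f s) (g s)).
Proof.
move=> rf rg; have := computable_iter1 computable_code_tail rg rf.
move=> /(computable_app1 computable_logn2)/eq_computable; apply => s.
rewrite -{1}(CodeSeq.decodeK (f s)) iter_code_tail /entry.
case: (ltnP (g s) (size (CodeSeq.decode (f s)))) => h.
  by rewrite (drop_nth 0 h) logn2_code.
(* Past the end the code is 0, and [logn 2 0 = 0] agrees with the padding of [entry]. *)
by rewrite drop_oversize// nth_default.
Qed.

Lemma size_decode x : size (CodeSeq.decode x) <= x.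
Proof.
rewrite -{2}(CodeSeq.decodeK x).
elim: (CodeSeq.decode x) => //= a s IH.
rewrite (@leq_trans (CodeSeq.code s).*2.+1)//.
  by rewrite ltnS (leq_trans IH)// -addnn leq_addr.
by rewrite leq_pmull// expn_gt0.
Qed.

(** The length is the number of iterated tails with nonzero code; by [size_decode] it suffices to
    count up to the code itself. *)
Lemma computable_size_decode f : computable f ->
  computable (fun s => size (CodeSeq.decode (f s))).
Proof.
move=> rf; have := computable_sum
  (G := fun s k => ~~ (iter k code_tail (f s) == 0) : nat) rf.
move=> /(_ _)/eq_computable; apply.
  move=> s; have := size_decode (f s); set n := size _.
  move=> sz; rewrite -[RHS](minn_idPr sz).
  have -> : \sum_(k < f s) (~~ (iter k code_tail (f s) == 0) : nat) =
      \sum_(k < f s) (k < n : nat).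
    apply: eq_bigr => k _; congr nat_of_bool.
    rewrite -[X in iter _ _ X](CodeSeq.decodeK (f s)) iter_code_tail.
    case: (ltnP k n) => h.
      by rewrite (drop_nth 0 h) /= muln_eq0 expn_eq0.
    by rewrite drop_oversize.
  exact: sum_ltn.
apply: computable_not; apply: computable_eq0.
apply: computable_iter1; first exact: computable_code_tail.
- exact: computable_nth.
- exact: computable_behead.
Qed.

Lemma computable_sum_decode (G : seq nat -> nat -> nat) h :
  computable h -> computable (fun s => G (behead s) (nth 0 s 0)) ->
  computable (fun s => \sum_(b <- CodeSeq.decode (h s)) G s b).
Proof.
move=> rh rG.
have := computable_sum (G := fun s k => G s (entry (h s) k))
  (computable_size_decode rh).
move=> /(_ _)/eq_computable; apply.
  by move=> s; rewrite (big_nth 0) big_mkord.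
apply: (@computable_subst_head (fun s => G (behead s) (nth 0 s 0))
  (fun s => entry (h (behead s)) (nth 0 s 0))) => //.
by apply: computable_entry; [exact: computable_behead|exact: computable_nth].
Qed.

Lemma computable_all_decode (b : seq nat -> nat -> bool) h :
  computable h -> computable (fun s => b (behead s) (nth 0 s 0)) ->
  computable (fun s => all (b s) (CodeSeq.decode (h s))).
Proof.
move=> rh rb.
have := computable_sum_decode (G := fun s k => ~~ b s k) rh (computable_not rb).
move=> /computable_eq0/eq_computable; apply => s; congr nat_of_bool.
by rewrite sum_nat_seq_eq0; apply: eq_all => k /=; case: (b s k).
Qed.

Lemma computable_has_decode (b : seq nat -> nat -> bool) h :
  computable h -> computable (fun s => b (behead s) (nth 0 s 0)) ->
  computable (fun s => has (b s) (CodeSeq.decode (h s))).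
Proof.
move=> rh rb; apply: eq_computable
  (computable_not (computable_all_decode rh (computable_not rb))) => s.
by rewrite -has_predC; congr nat_of_bool; apply: eq_has => k; exact: negbK.
Qed.

(** * Unbounded search and enumerable sets *)

Lemma computable_min (b : seq nat -> bool) :
  computable b -> (forall s, exists k, b (k :: s)) ->
  exists2 g, computable g & forall s, b (g s :: s).
Proof.
move=> rb eb; pose g s := ex_minn (eb s); exists g; last first.
  by move=> s; rewrite /g; case: ex_minnP.
move=> n; apply: (recursive_min (computable_not rb n.+1)) => t.
rewrite /g; case: ex_minnP => m /= bm min_m; split; first by rewrite bm.
by move=> k km; case: (boolP (b _)) => //= /min_m; rewrite leqNgt km.
Qed.

(** A total enumeration runs through all pairs of a candidate and a witness, and repeats a fixed
    element [m0] whenever the witness fails. *)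
Lemma enumerable_exists (b : seq nat -> bool) :
  computable b -> enumerable [set m | exists w, b [:: m; w]].
Proof.
move=> rb; case: (pselect (exists m w, b [:: m; w])) => [[m0 [w0 b0]]|nb]; last first.
  left; apply/seteqP; split=> // m [w bmw]; apply: nb; by exists m, w.
right.
pose b' s := let z := nth 0 s 0 in b [:: entry z 0; entry z 1].
pose g s := if b' s then entry (nth 0 s 0) 0 else m0.
have rg i : computable (fun s => entry (nth 0 s 0) i).
  by apply: computable_entry; [exact: computable_nth|exact: computable_const].
exists (fun t => g t); split.
  apply: (computable_if (b := b') _ (rg 0) (computable_const m0)) 1.
  apply: (computable_comp (gs := [:: fun s => entry (nth 0 s 0) 0;
    fun s => entry (nth 0 s 0) 1]) rb) => -[|[|[|i]]] //=; exact: computable_zero.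
apply/seteqP; split=> [m [w bmw]|_ [z _ <-]] /=.
  exists (CodeSeq.code [:: m; w]) => //.
  set z := CodeSeq.code _; have ez i : entry z i = nth 0 [:: m; w] i.
    by rewrite /entry CodeSeq.codeK.
  by rewrite /g /b' /= !ez bmw.
rewrite /g; case: ifP => [bz|_]; first by exists (entry z 1).
by exists w0.
Qed.

End computable.

Lemma entry_code (s : seq nat) (i : nat) :
  entry (CodeSeq.code s) i = nth 0%N s i.
Proof. by rewrite /entry CodeSeq.codeK. Qed.

(* Simplification would otherwise replace codes by sums of powers of two. *)
Arguments CodeSeq.code : simpl never.

(** * The Prokhorov distance *)

Section prokhorov_theory.
Context {R : realType} {X : completeMetricType R}.
Implicit Types (P Q : M X) (A G : set (borel X)).

Lemma open_measurable_borel G : open (G : set X) -> measurable G.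
Proof. exact: sub_sigma_algebra. Qed.

Lemma enlarge_mono (A : set X) (d e : R) :
  d <= e -> enlarge A d `<=` enlarge A e.
Proof. by move=> de x [y Ay yx]; exists y; rewrite // (lt_le_trans yx). Qed.

Lemma prokhorov_lt P Q (e : R) A : prokhorov P Q < e -> measurable A ->
  (P A <= Q (enlarge A e) + e%:E)%E.
Proof.
move=> PQ mA; have [d [d0 Hd] de] := inf_lt (prokhorov_has_inf P Q).1 PQ.
apply: le_trans (Hd _ mA).1 _; apply: leeD; last by rewrite lee_fin ltW.
apply: le_measure; rewrite ?inE; [exact: enlarge_measurable..|].
exact/enlarge_mono/ltW.
Qed.

(** The reverse inequality comes from applying the given one to the complement of [enlarge A e],
    whose own enlargement does not meet [A]. *)
Lemma prokhorov_le P Q (e : R) : 0 < e ->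
  (forall A, measurable A -> (P A <= Q (enlarge A e) + e%:E)%E) ->
  prokhorov P Q <= e.
Proof.
move=> e0 H; apply: ge_inf; first by exists 0 => d [/ltW].
split=> // A mA; split; first exact: H.
have mB := enlarge_measurable A e; set B : set (borel X) := enlarge A e in mB *.
have := H _ (measurableC mB).
have : (Q (enlarge (~` B) e) <= Q (~` A))%E.
  apply: le_measure; rewrite ?inE; [exact: enlarge_measurable|exact: measurableC|].
  by move=> x [y nBy yx] Ax; apply: nBy; exists x; rewrite // metric_sym.
rewrite !probability_setC//.
have [mA' mB'] := (fin_num_measure Q A mA, fin_num_measure P B mB).
rewrite -(fineK mA') -(fineK mB') => h1 h2.
have := le_trans h2 (leeD2r _ h1).
by rewrite -!EFinB -!EFinD !lee_fin; lra.
Qed.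

Lemma mu_bigcup_gt d (T : measurableType d) (P : probability T R)
    (F : (set T)^nat) (c : R) :
  (forall n, measurable (F n)) -> {homo F : n m / (n <= m)%N >-> n `<=` m} ->
  (c%:E < P (\bigcup_n F n))%E ->
  \forall n \near \oo, (c%:E < P (F n))%E.
Proof.
move=> mF ndF cP; have mU : measurable (\bigcup_n F n) by exact: bigcup_measurable.
have ndF' : {homo F : n m / (n <= m)%N >-> (n <= m)%O}.
  by move=> n m nm; apply/subsetPset; exact: ndF.
have fU := fin_num_measure P _ mU.
have cv : P (F n) @[n --> \oo] --> (fine (P (\bigcup_n F n)))%:E.
  by rewrite fineK//; exact: (nondecreasing_cvg_mu (mu := P) mF mU ndF').
rewrite -(fineK fU) in cP.
have [_ /cvgr_gt/(_ c)] := iffLR (fine_cvgP _ _) cv.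
rewrite -lte_fin => /(_ cP); apply: filterS => n /=.
by rewrite -lte_fin fineK// fin_num_measure.
Qed.

(** An open set is the increasing union of its points at distance at least 1/(n+1) from the
    complement, and enlarging these by 1/(n+1) stays inside. So measures at distance 0 agree on open
    sets, a generating class closed under intersection. *)
Lemma prokhorov_gt0 P Q : ~ (P ≡μ Q) -> 0 < prokhorov P Q.
Proof.
move=> PQ; rewrite ltNge; apply/negP => PQ0; apply: PQ.
have le_open (P' Q' : M X) (G : set (borel X)) :
    prokhorov P' Q' <= 0 -> open (G : set X) -> (P' G <= Q' G)%E.
  move=> PQ'0 oG; have mG := open_measurable_borel oG.
  rewrite leNgt; apply/negP.
  rewrite -(fineK (fin_num_measure P' _ mG)) -(fineK (fin_num_measure Q' _ mG)).
  set p := fine (P' G); set q := fine (Q' G); rewrite lte_fin => qp.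
  pose F n : set (borel X) := ~` enlarge (~` G) n.+1%:R^-1.
  have mF n : measurable (F n) by apply: measurableC; exact: enlarge_measurable.
  have ndF : {homo F : n m / (n <= m)%N >-> n `<=` m}.
    move=> n m nm x + ex; apply; apply: enlarge_mono ex.
    by rewrite lef_pV2 ?posrE// ler_nat.
  have UF : \bigcup_n F n = G.
    apply/seteqP; split=> [x [n _] Fnx|x Gx].
      by apply/not_notP => nGx; apply: Fnx; exists x; rewrite ?mdistxx.
    have : nbhs (x : X) G by exact: open_nbhs_nbhs.
    rewrite -nbhs_ballE => -[e /= e0]; rewrite ballEmdist => eG.
    have [n _ ne] := near_infty_natSinv_lt (PosNum e0).
    exists n => // -[y nGy yx]; apply: nGy; apply: eG => /=.
    by rewrite metric_sym (lt_trans yx (ne n (leqnn n))).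
  (* The gap between [c] and [q] absorbs the term 1/(n+1) of the Prokhorov inequality. *)
  pose c := (p + q) / 2.
  have : (c%:E < P' (\bigcup_n F n))%E.
    rewrite UF -(fineK (fin_num_measure P' _ mG)) lte_fin -/p /c; lra.
  move=> /(mu_bigcup_gt mF ndF); have e0 : 0 < c - q by rewrite /c; lra.
  move=> /(filterI (near_infty_natSinv_lt (PosNum e0)))[n _ /(_ n (leqnn n))[/= nc]].
  apply/negP; rewrite -leNgt.
  have n0 : prokhorov P' Q' < n.+1%:R^-1 by rewrite (le_lt_trans PQ'0).
  apply: (le_trans (prokhorov_lt n0 (mF n))).
  apply: (@le_trans _ _ (Q' G + n.+1%:R^-1%:E)%E).
    apply: leeD => //; apply: le_measure; rewrite ?inE //.
      exact: enlarge_measurable.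
    move=> x [y Fny yx]; apply/not_notP => nGx; apply: Fny.
    by exists x; rewrite // metric_sym.
  rewrite -(fineK (fin_num_measure Q' _ mG)) -EFinD lee_fin -/q.
  by rewrite -lerBrDl ltW.
have eqG (G : set (borel X)) : open (G : set X) -> P G = Q G.
  move=> oG; apply/eqP; rewrite eq_le !le_open//.
  by rewrite prokhorov_sym.
move=> A mA.
have := @measure_unique _ R (borel X) (@open X) (fun=> setT) erefl _ _ _ P Q.
apply => //.
- by move=> B D; exact: openI.
- by move=> _; exact: openT.
- by rewrite bigcup_const.
- by move=> n; rewrite (le_lt_trans (probability_le1 _ _)) ?ltry.
Qed.

Lemma open_ball_prokhorov P (e : R) : open (ball P e).
Proof.
rewrite openE => Q; rewrite ball_prokhorovE /= => PQ.
rewrite /interior -nbhs_ballE; exists (e - prokhorov P Q) => /=.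
  by rewrite subr_gt0.
move=> S; rewrite !ball_prokhorovE /= => QS.
by rewrite (le_lt_trans (prokhorov_triangle P Q S))// -ltrBrDl.
Qed.

End prokhorov_theory.

(** * Density of the rational measures *)

(** Kept as a natural number, before normalization, so that comparing a measure with a rational
    becomes integer arithmetic. *)
Definition weight (m : nat) (p : pred nat) : nat :=
  \sum_(k <- CodeSeq.decode m) entry k 1 * p (entry k 0).

Section rational_measure.
Context {R : realType} {X : completeMetricType R}.
Variable alpha : nat -> X.
Implicit Types (P : M X) (A : set (borel X)) (m : nat).

Lemma rational_measureE m A : (0 < weight m xpredT)%N ->
  rational_measure alpha m A =
  ((weight m (fun i => `[< A (alpha i) >]))%:R / (weight m xpredT)%:R)%:E.
Proof.
move=> m0.
have sumE (B : set (borel X)) : (\sum_(k < size (CodeSeq.decode m))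
    (entry (nth 0%N (CodeSeq.decode m) k) 1)%:R%:E *
      @dirac _ (borel X) (alpha (entry (nth 0%N (CodeSeq.decode m) k) 0)) R B =
    (weight m (fun i => `[< B (alpha i) >]))%:R%:E)%E.
  rewrite /weight (big_nth 0%N) big_mkord natr_sum -sumEFin.
  apply: eq_bigr => k _; by rewrite diracE natrM EFinM.
rewrite /rational_measure /= /mnormalize /= /msum /mscale /= !sumE.
have -> : weight m (fun i => `[< [set: borel X] (alpha i) >]) = weight m xpredT.
  by apply: eq_bigr => k _; rewrite asboolT.
rewrite eqe pnatr_eq0 -[_ == 0%N]negbK -lt0n m0 /=.
by rewrite EFinM; congr (_ * _)%E; exact: sumE.
Qed.

Lemma weight_le m (p q : pred nat) : subpred p q -> (weight m p <= weight m q)%N.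
Proof.
move=> pq; apply: leq_sum => k _; rewrite leq_mul2l.
by case: (p _) (pq (entry k 0)) => [/(_ isT)->|_]; rewrite ?leqnn ?leq0n orbT.
Qed.

Hypothesis dense_alpha : dense (range alpha).

Lemma bigcup_ball_dense (e : R) : 0 < e -> \bigcup_i ball (alpha i) e = setT.
Proof.
move=> e0; apply/seteqP; split=> // x _.
have [y [xy [i _ yi]]] : (ball x e)° `&` range alpha !=set0.
  apply: dense_alpha; last exact: open_interior.
  exists x; rewrite /interior -nbhs_ballE; by exists e.
by move: xy => /interior_subset /ball_sym; rewrite -yi; exists i.
Qed.

(** The pair in front, at index 0, takes up the weight [r] that rounding leaves over. *)
Lemma weight_code (w : nat -> nat) (k r : nat) (p : pred nat) :
  weight (CodeSeq.code (CodeSeq.code [:: 0%N; r] ::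
    [seq CodeSeq.code [:: i; w i] | i <- iota 0 k])) p =
  (r * p 0%N + \sum_(i < k) w i * p i)%N.
Proof.
rewrite /weight CodeSeq.codeK big_cons big_map !entry_code /=.
congr (_ + _)%N; rewrite -[k in iota _ k]subn0 big_mkord.
by apply: eq_bigr => i _; rewrite !entry_code.
Qed.

(** Balls of radius d are made disjoint, and finitely many of them carry mass above 1 - d. Their
    masses are rounded down to multiples of 1/N. The lost tail and the rounding cost at most d
    each. *)
Lemma prokhorov_dense P (e : R) : 0 < e ->
  exists2 m, (0 < weight m xpredT)%N & prokhorov P (rational_measure alpha m) < e.
Proof.
move=> e0; pose d := e / 4; have d0 : 0 < d by rewrite divr_gt0.
pose B i : set (borel X) := ball (alpha i) d.
have mB i : measurable (B i).
  apply: open_measurable_borel; rewrite /B.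
  have -> : ball (alpha i) d = enlarge [set alpha i] d.
    rewrite ballEmdist; apply/seteqP; split=> [y yd|y [_ ->]//].
    by exists (alpha i).
  exact: enlarge_open.
pose D i := seqDU B i.
have mD i : measurable (D i).
  by apply: measurableD => //; exact: bigsetU_measurable.
have tD : trivIset setT D by exact: trivIset_seqDU.
pose U k := \bigcup_(i < k) D i.
have mU k : measurable (U k) by exact: bigcup_measurable.
have UT : \bigcup_k U k = setT.
  rewrite -(bigcup_ball_dense d0) -/B (seqDU_bigcup_eq B).
  apply/seteqP; split=> [x [k _ [i _ Dix]]|x [i _ Dix]]; first by exists i.
  by exists i.+1 => //; exists i => /=.
have ndU : {homo U : n m / (n <= m)%N >-> n `<=` m}.
  by move=> n k nk x [i /= ik Dix]; exists i => //=; exact: leq_trans nk.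
have := @mu_bigcup_gt _ _ _ P U (1 - d) mU ndU.
rewrite UT probability_setT => /(_ _)/wrap[|].
  by rewrite lte_fin ltrBlDr ltrDl.
move=> [k _ /(_ k (leqnn k))/= dU].
pose p i : R := fine (P (D i)).
have pE i : P (D i) = (p i)%:E by rewrite fineK// fin_num_measure.
have p0 i : 0 <= p i by rewrite -lee_fin -pE.
have sum_p : \sum_(i < k) p i <= 1.
  rewrite -lee_fin -sumEFin.
  under eq_bigr do rewrite -pE.
  rewrite -measure_bigsetU//; apply: probability_le1.
  exact: bigsetU_measurable.
(* With this denominator, rounding k masses down loses less than d in total. *)
pose N := (Num.truncn (k%:R / d)).+1.
have N0 : (0 : R) < N%:R by rewrite ltr0n.
have kN : k%:R < d * N%:R.
  rewrite -ltr_pdivrMl// mulrC.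
  by have /andP[] := truncn_itv (divr_ge0 (ler0n R k) (ltW d0)).
pose w i := Num.truncn (N%:R * p i).
have wP i : ((w i)%:R <= N%:R * p i < (w i).+1%:R).
  by apply: truncn_itv; rewrite mulr_ge0.
have wN : (\sum_(i < k) w i <= N)%N.
  rewrite -(ler_nat R) natr_sum.
  apply: (@le_trans _ _ (\sum_(i < k) N%:R * p i)).
    by apply: ler_sum => i _; have /andP[] := wP i.
  by rewrite -mulr_sumr ler_piMr.
pose m := CodeSeq.code (CodeSeq.code [:: 0%N; (N - \sum_(i < k) w i)%N] ::
  [seq CodeSeq.code [:: i; w i] | i <- iota 0 k]).
have mN : weight m xpredT = N.
  rewrite weight_code muln1 -[RHS](subnK wN); congr (_ + _)%N.
  by apply: eq_bigr => i _; rewrite muln1.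
exists m; first by rewrite mN.
apply: (@le_lt_trans _ _ (d *+ 2)); last by rewrite /d; lra.
apply: prokhorov_le; first by rewrite mulrn_wgt0.
move=> A mA.
rewrite rational_measureE mN// weight_code.
pose q i := `[< enlarge A (d *+ 2) (alpha i) >].
pose F i := if q i then D i else set0.
have mF i : measurable (F i) by rewrite /F; case: ifP.
(* A piece [D i] that meets [A] has its centre in the enlargement of [A], so it is counted by
   [q]. *)
have sub : A `<=` \big[setU/set0]_(i < k) F i `|` ~` U k.
  move=> x Ax; case: (pselect (U k x)) => [[i /= ik Dix]|]; last by right.
  left; rewrite -bigcup_mkord; exists i => //=.
  rewrite /F /q asboolT//; exists x => //; move: Dix.1; rewrite /B ballEmdist /=.
  by rewrite metric_sym => /lt_le_trans; apply; rewrite mulr2n lerDl ltW.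
apply: (@le_trans _ _ (\sum_(i < k) (if q i then p i else 0)%:E + d%:E)%E).
  have mF' : measurable (\big[setU/set0]_(i < k) F i) by exact: bigsetU_measurable.
  apply: (@le_trans _ _ (P (\big[setU/set0]_(i < k) F i) + P (~` U k))%E).
    apply: le_trans (measureU2 _ _ _) => //; last exact: measurableC.
    apply: le_measure; rewrite ?inE//.
    by apply: measurableU => //; exact: measurableC.
  apply: leeD; last first.
    rewrite probability_setC//; move: dU.
    rewrite -(fineK (fin_num_measure P _ (mU k))) lte_fin -EFinB lee_fin; lra.
  apply: le_trans (@Boole_inequality _ _ _ P F k _) _ => //.
  apply: lee_sum => i _; rewrite /F; case: ifP => _; last by rewrite measure0.
  by rewrite -pE.
rewrite sumEFin -!EFinD lee_fin mulr2n addrA lerD2r.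
rewrite -lerBlDr ler_pdivlMr// mulrBl.
rewrite -(lerD2r (d * N%:R)) subrK.
(* After scaling by N each term loses at most 1 by truncation, and k < d N. *)
apply: (@le_trans _ _ (\sum_(i < k) ((w i * q i)%N%:R + 1))).
  rewrite mulr_suml; apply: ler_sum => i _.
  have /andP[_ /ltW] := wP i; rewrite mulrC -natr1.
  by case: (q i); rewrite ?muln1// mul0r muln0 add0r ler01.
rewrite big_split /= -natr_sum sumr_const card_ord lerD//; last exact: ltW.
by rewrite ler_nat leq_addl.
Qed.

End rational_measure.

(** * Certificates for lower bounds on measures *)

Section charged.
Context {R : realType} {X : completeMetricType R}.
Variable alpha : nat -> X.
Implicit Types (P Q : M X) (A G : set (borel X)) (U V : seq nat) (c r : R).

Local Notation center b := (alpha (entry b 0)).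
Local Notation radius b := (@pos_rational R (entry b 1)).
Local Notation mu := (rational_measure alpha).

(** A checkable substitute for the points at distance more than [r] from the complement of the union
    of the balls: it only compares distances between points with rationals. For [r = 0] it is that
    union. *)
Definition inner V r : set (borel X) :=
  [set x | exists2 b, b \in V & mdist x (center b) + r < radius b].

(* Formal disjointness of two basic balls. *)
Definition apart (a b : nat) : bool :=
  radius a + radius b < mdist (center a) (center b).

(* A certificate that [P (inner V 0) > c] for every [P] in the basic ball [b]. *)
Definition charged c V (b : nat) : bool :=
  let m := entry b 0 in
  (c + radius b) * (weight m xpredT)%:R <
  (weight m (fun i => `[< inner V (radius b) (alpha i) >]))%:R.

Lemma open_mdist_lt (x : X) r : open [set y : X | mdist y x < r].
Proof.
have -> : [set y : X | mdist y x < r] = enlarge [set x] r.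
  apply/seteqP; split=> [y yx|y [_ ->]]; last by rewrite metric_sym.
  by exists x; rewrite // metric_sym.
exact: enlarge_open.
Qed.

Lemma open_mdist_gt (x : X) r : open [set y : X | r < mdist y x].
Proof.
rewrite openE => y /= ry; rewrite /interior -nbhs_ballE.
exists (mdist y x - r) => /=; first by rewrite subr_gt0.
move=> z; rewrite ballEmdist /= => yz; have := metric_triangle y z x; lra.
Qed.

Lemma inner_open V r : open (inner V r : set X).
Proof.
have -> : (inner V r : set X) =
    \bigcup_(b in [set` V]) [set x : X | mdist x (center b) < radius b - r].
  by apply/seteqP; split=> x [b bV xb]; exists b; rewrite //= ltrBrDr in xb *.
by apply: bigcup_open => b _; exact: open_mdist_lt.
Qed.

Lemma inner_sub U V r d : {subset U <= V} -> d <= r ->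
  inner U r `<=` inner V d.
Proof.
move=> UV dr x [b bU xb]; exists b; first exact: UV.
by apply: le_lt_trans xb; rewrite lerD2l.
Qed.

Lemma enlarge_inner V r d : enlarge (inner V (r + d)) d `<=` inner V r.
Proof.
move=> x [y [b bV yb] yx]; exists b => //.
by have := metric_triangle x y (center b); rewrite (metric_sym x y); lra.
Qed.

Lemma chargedE c V b : charged c V b ->
  ((c + radius b)%:E < mu (entry b 0) (inner V (radius b)))%E.
Proof.
rewrite /charged => cb.
(* With a null total weight both sides of the certificate would be 0, so the default point mass
   never arises. *)
have m0 : (0 < weight (entry b 0) xpredT)%N.
  rewrite lt0n; apply/negP => /eqP m0; move: cb; rewrite m0 mulr0 ltr0n => h.
  have : (0 < weight (entry b 0) xpredT)%N.
    by apply: leq_trans h _; exact: weight_le.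
  by rewrite m0.
by rewrite rational_measureE// lte_fin ltr_pdivlMr// ltr0n.
Qed.

(** Going from the centre of the ball to [P] costs the radius twice: once as mass, which the summand
    in [charged] pays, and once as enlargement, which the margin in [inner] pays. *)
Lemma charged_sound c V b P : charged c V b -> basic_ball mu b P ->
  (c%:E < P (inner V 0))%E.
Proof.
move=> /chargedE; rewrite /basic_ball ball_prokhorovE /= => cb Pb.
have := prokhorov_lt Pb (open_measurable_borel (inner_open V (radius b))).
move=> /(lt_le_trans cb); rewrite EFinD lteD2rE// => /lt_le_trans; apply.
apply: le_measure; rewrite ?inE; first exact: enlarge_measurable.
  by apply: open_measurable_borel; exact: inner_open.
by rewrite -[X in inner V X]add0r; exact: enlarge_inner.
Qed.

Lemma charged_sub c U V b : {subset U <= V} -> charged c U b -> charged c V b.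
Proof.
move=> UV; rewrite /charged => /lt_le_trans; apply; rewrite ler_nat.
by apply: weight_le => i /asboolP ?; apply/asboolP; exact: inner_sub UV _ _ _.
Qed.

Hypothesis dense_alpha : dense (range alpha).

(** Certificates are complete: a strict lower bound on an open union of balls is already reached by
    finitely many of them with a small margin, and it passes to a rational measure close to [P]. *)
Lemma charged_exists (phi : set nat) G P c : measurable G ->
  (forall x, G x -> exists2 b, phi b & mdist x (center b) < radius b) ->
  (c%:E < P G)%E ->
  exists V b, [/\ {in V, forall a, phi a}, basic_ball mu b P & charged c V b].
Proof.
move=> mG Gphi cP.
pose V n := [seq a <- iota 0 n | `[< phi a >]].
(* One half of the margin is spent in passing from [P] to a rational measure, the other is the
   margin of the certificate. *)
pose F n := inner (V n) (n.+1%:R^-1 *+ 2).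
have invle (n m : nat) : (n <= m)%N -> m.+1%:R^-1 <= n.+1%:R^-1 :> R.
  by move=> nm; rewrite lef_pV2 ?posrE// ler_nat.
have mF n : measurable (F n).
  by apply: open_measurable_borel; exact: inner_open.
have ndF : {homo F : n m / (n <= m)%N >-> n `<=` m}.
  move=> n m nm; apply: inner_sub; last by rewrite lerMn2r invle.
  move=> a; rewrite !mem_filter !mem_iota => /andP[-> /=].
  by move=> an; exact: leq_trans an nm.
have GF : G `<=` \bigcup_n F n.
  move=> x /Gphi[b phib xb].
  have e0 : 0 < (radius b - mdist x (center b)) / 2 by rewrite divr_gt0// subr_gt0.
  have [n _ /(_ (maxn n b.+1) (leq_maxl _ _)) /= ne] :=
    near_infty_natSinv_lt (PosNum e0).
  exists (maxn n b.+1) => //; exists b.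
    by rewrite mem_filter asboolT// mem_iota /= add0n leq_maxr.
  suff key (u : R) : u < (radius b - mdist x (center b)) / 2 ->
      mdist x (center b) + u *+ 2 < radius b by exact: key.
  by rewrite -(mulr_natr u); lra.
(* The room between [c] and [c'] pays both for the distance to the rational measure and for the
   radius in the certificate. *)
have : exists2 c', c < c' & (c'%:E < P (\bigcup_n F n))%E.
  have mUF : measurable (\bigcup_n F n) by exact: bigcup_measurable.
  have : (c%:E < P (\bigcup_n F n))%E.
    by apply: lt_le_trans cP _; apply: le_measure; rewrite ?inE.
  rewrite -(fineK (fin_num_measure P _ mUF)) lte_fin; set p := fine _ => cp.
  exists ((c + p) / 2); rewrite ?lte_fin; lra.
move=> [c' cc' /(mu_bigcup_gt mF ndF)]; have e0 : 0 < (c' - c) / 2 by lra.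
move=> /(filterI (near_infty_natSinv_lt (PosNum e0)))[n _ /(_ n (leqnn n))[/= nc Fn]].
move: Fn; rewrite /F; set r := n.+1%:R^-1 in nc * => Fn.
have r0 : 0 < r by rewrite invr_gt0 ltr0n.
have [m m0 Pm] := prokhorov_dense dense_alpha P r0.
pose b := CodeSeq.code [:: m; CodeSeq.code [:: 0%N; n]].
have rb : radius b = r by rewrite /pos_rational !entry_code /= div1r.
exists (V n), b; split.
- by move=> a; rewrite mem_filter => /andP[/asboolP].
- by rewrite /basic_ball rb ball_prokhorovE /= entry_code /= prokhorov_sym.
rewrite /charged rb entry_code /=.
rewrite -ltr_pdivlMr ?ltr0n// -lte_fin -rational_measureE//.
have mFn : measurable (inner (V n) (r + r)).
  by apply: open_measurable_borel; exact: inner_open.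
have mFr : measurable (inner (V n) r).
  by apply: open_measurable_borel; exact: inner_open.
have := prokhorov_lt Pm mFn; rewrite mulr2n in Fn.
move=> /(lt_le_trans Fn).
have : (mu m (enlarge (inner (V n) (r + r)) r) <= mu m (inner (V n) r))%E.
  apply: le_measure; rewrite ?inE//; first exact: enlarge_measurable.
  exact: enlarge_inner.
move=> h1 h2; have := lt_le_trans h2 (leeD2r _ h1).
rewrite -(fineK (fin_num_measure (mu m) _ mFr)) -EFinD !lte_fin; lra.
Qed.

(** Each member of [C] lies in a ball of [N] or in one with a certificate. Compactness keeps
    finitely many such balls, and their lists are merged, since a certificate survives when [V]
    grows. *)
Lemma compact_charged (C : set (M X)) (N : seq nat) (phi : set nat) G c :
  compact C -> measurable G ->
  (forall x, G x -> exists2 b, phi b & mdist x (center b) < radius b) ->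
  (forall P, C P -> (forall b, b \in N -> ~ basic_ball mu b P) -> (c%:E < P G)%E) ->
  exists V (L : seq nat), [/\ {in V, forall a, phi a},
    C `<=` \bigcup_(b in [set` L]) basic_ball mu b &
    {in L, forall b, b \notin N -> charged c V b}].
Proof.
move=> cC mG Gphi CG.
pose good b V := {in V, forall a, phi a} /\ (b \notin N -> charged c V b).
pose D : set nat := [set b | exists V, good b V].
move: cC; rewrite compact_cover => /(_ nat D (basic_ball mu)) [].
- by move=> b _; exact: open_ball_prokhorov.
- move=> P CP.
  case: (pselect (exists2 b, b \in N & basic_ball mu b P)) => [[b bN bP]|nN].
    by exists b => //; exists [::]; split=> //; rewrite bN.
  have [|V [b [Vphi bP cb]]] := charged_exists mG Gphi (CG P CP _).
    by move=> b bN bP; apply: nN; exists b.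
  by exists b => //; exists V.
move=> L LD CL.
have /choice[W HW] : forall b, exists V, D b -> good b V.
  by move=> b; case: (pselect (D b)) => [[V gV]|nD]; [exists V|exists [::]].
exists (flatten [seq W b | b <- finmap.enum_fset L]), (finmap.enum_fset L); split=> //.
- move=> a /flatten_mapP[b bL aW].
  by have [|+ _] := HW b; [have := LD b bL; rewrite inE|exact].
- move=> b bL bN; have [|_ /(_ bN)] := HW b.
    by have := LD b bL; rewrite inE.
  by apply: charged_sub => a aW; apply/flatten_mapP; exists b.
Qed.

End charged.

(** * Finite unions of balls from a separator *)

Section separation.
Context {R : realType} {X : completeMetricType R}.
Variable alpha : nat -> X.
Implicit Types (P Q : M X) (N : seq nat).

Local Notation center b := (alpha (entry b 0)).
Local Notation radius b := (@pos_rational R (entry b 1)).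
Local Notation mu := (rational_measure alpha).

Lemma lsc_measurable (g : borel X -> \bar R) :
  lower_semicontinuous (g : X -> \bar R) -> measurable_fun [set: borel X] g.
Proof.
move=> /lower_semicontinuousP og.
apply: (measurability _ (ErealGenOInfty.measurableE R)).
move=> /= _ [_ [a ->]] <-; apply: measurableI => //.
by rewrite preimage_itvoy; apply: open_measurable_borel; exact: og.
Qed.

Variable s : X * M X -> \bar R.
Hypotheses (s_ge0 : forall z, (0 <= s z)%E) (s_lsc : lower_semicontinuous s)
  (s_int : normalized s).

Lemma lsc_section P : lower_semicontinuous (fun x => s (x, P)).
Proof.
move=> x a /s_lsc[V [[U1 U2] /= [xU1 PU2] UV] Va].
exists U1 => // y yU1; apply: Va; apply: UV; split=> //=.
exact: nbhs_singleton.
Qed.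

Lemma lsc_section_markov P (a : R) : 0 < a ->
  (a%:E * P [set x | a%:E < s (x, P)]%E <= 1)%E.
Proof.
move=> a0; have ms := lsc_measurable (lsc_section (P := P)).
have ma : measurable [set x : borel X | (a%:E < s (x, P))%E].
  apply: open_measurable_borel.
  by move/lower_semicontinuousP: (lsc_section (P := P)); exact.
apply: le_trans (s_int P).
rewrite -integral_cst//.
apply: (@le_trans _ _
  (\int[P]_(x in [set x : borel X | (a%:E < s (x, P))%E]) s (x, P))%E).
  apply: ge0_le_integral => //.
  - by move=> x _ /=; rewrite lee_fin ltW.
  - exact: measurable_funS ms.
  - by move=> x /ltW.
by apply: ge0_subset_integral.
Qed.

(** Within [C] this cuts out the compact sets C1 and C2, described by finite lists that a program
    can contain. *)
Definition avoids N P : Prop := forall b, b \in N -> ~ basic_ball mu b P.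

(** A tube argument over the compact [C]: near a measure in a ball of [N] the condition is vacuous,
    and near the others joint lower semicontinuity gives a product neighbourhood. *)
Lemma lsc_above_open (C : set (M X)) N (a : R) : compact C ->
  open [set x : X | forall P, C P -> avoids N P -> (a%:E < s (x, P))%E].
Proof.
move=> /compact_near_coveringP cC; rewrite openE => x Hx.
have := cC _ (nbhs x)
  (fun x P => avoids N P -> (a%:E < s (x, P))%E) _ _.
apply=> P CP.
case: (pselect (exists2 b, b \in N & basic_ball mu b P)) => [[b bN bP]|nN].
  exists (basic_ball mu b, setT) => /=.
    split; last exact: filterT.
    by apply: open_nbhs_nbhs; split=> //; exact: open_ball_prokhorov.
  by move=> [Q y] [/= bQ _] /(_ b bN bQ).
have aP : avoids N P by move=> b bN bP; apply: nN; exists b.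
have [V [[U1 U2] /= [xU1 PU2] UV] Va] := s_lsc (Hx P CP aP).
exists (U2, U1) => // -[Q y] [/= QU2 yU1] _.
by apply: Va; apply: UV.
Qed.

Hypothesis dense_alpha : dense (range alpha).

Lemma small_ball (x : X) (n : nat) :
  exists2 b, radius b = n.+1%:R^-1 & mdist x (center b) < radius b.
Proof.
have r0 : 0 < n.+1%:R^-1 :> R by rewrite invr_gt0 ltr0n.
have [i _ xi] : (\bigcup_i ball (alpha i) n.+1%:R^-1) x.
  by rewrite bigcup_ball_dense.
have rb : @pos_rational R (entry (CodeSeq.code
    [:: i; CodeSeq.code [:: 0%N; n]]) 1) = n.+1%:R^-1.
  by rewrite /pos_rational !entry_code /= div1r.
exists (CodeSeq.code [:: i; CodeSeq.code [:: 0%N; n]]) => //.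
by rewrite rb entry_code /=; move: xi; rewrite ballEmdist /= metric_sym.
Qed.

Lemma near_seq (I : Type) (F : set_system I) (T : eqType) (l : seq T)
    (p : T -> I -> Prop) : Filter F ->
  (forall a, a \in l -> \forall i \near F, p a i) ->
  \forall i \near F, forall a, a \in l -> p a i.
Proof.
move=> FF; elim: l => [|a l IH] H; first exact: nearW.
have pl := IH (fun b bl => H b (mem_behead (s := a :: l) bl)).
apply: filterS (filterI (H a (mem_head a l)) pl) => i [pa {}pl] b.
by rewrite inE => /predU1P[->//|]; exact: pl.
Qed.

Lemma apart_sym a b : apart alpha a b = apart alpha b a.
Proof. by rewrite /apart addrC metric_sym. Qed.

(** A radius below half of every gap between [x] and the closed balls of [U] is enough. *)
Lemma small_apart_ball (U : seq nat) (x : X) :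
  {in U, forall a, radius a < mdist x (center a)} ->
  exists2 b, {in U, forall a, apart alpha a b} & mdist x (center b) < radius b.
Proof.
move=> Ux.
have /near_seq[n _ /(_ n (leqnn n)) /= Un] : forall a, a \in U ->
    \forall n \near \oo, n.+1%:R^-1 < (mdist x (center a) - radius a) / 2.
  move=> a /Ux; rewrite -subr_gt0 => a0.
  have a20 : 0 < (mdist x (center a) - radius a) / 2 by rewrite divr_gt0.
  exact: (near_infty_natSinv_lt (PosNum a20)).
have [b rb xb] := small_ball x n; exists b => // a aU.
have : radius b < (mdist x (center a) - radius a) / 2 by rewrite rb; exact: Un.
have := metric_triangle x (center b) (center a).
by rewrite (metric_sym (center b)) /apart; lra.
Qed.

(** By Markov's inequality [A N] is small for the members of [C] avoiding [N], and by separation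
    [A N1] and [A N2] cover the space. First [U] is chosen inside [A N1], then [V] in the exterior
    of [U], so the two choices are not symmetric. *)
Lemma separated_lists (C : set (M X)) (N1 N2 : seq nat) (eps : R) :
  compact C -> 0 < eps ->
  (exists2 P, C P & avoids N1 P) -> (exists2 P, C P & avoids N2 P) ->
  (forall P Q, C P -> C Q -> avoids N1 P -> avoids N2 Q ->
    forall x, s (x, P) = +oo%E \/ s (x, Q) = +oo%E) ->
  exists U V L1 L2 : seq nat, [/\ {in U & V, forall a b, apart alpha a b},
    C `<=` \bigcup_(b in [set` L1]) basic_ball mu b,
    C `<=` \bigcup_(b in [set` L2]) basic_ball mu b,
    {in L1, forall b, b \notin N1 -> charged alpha (1 - eps) V b} &
    {in L2, forall b, b \notin N2 -> charged alpha (1 - eps) U b}].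
Proof.
move=> cC e0 [P1 CP1 aP1] [P2 CP2 aP2] sep.
(* With this threshold Markov's inequality gives eps / 2, strictly below eps. *)
pose a := 2 / eps; have a0 : 0 < a by rewrite divr_gt0.
pose A N : set (borel X) :=
  [set x | forall P, C P -> avoids N P -> (a%:E < s (x, P))%E].
have oA N : open (A N : set X) by exact: lsc_above_open.
have mA N : measurable (A N) by exact: open_measurable_borel.
have PA N P : C P -> avoids N P -> (P (A N) < eps%:E)%E.
  move=> CP aP; have := lsc_section_markov P a0.
  set S := [set x | _]; have mS : measurable (S : set (borel X)).
    apply: open_measurable_borel.
    by move/lower_semicontinuousP: (lsc_section (P := P)); exact.
  have : (P (A N) <= P S)%E.
    by apply: le_measure; rewrite ?inE// => x; apply.
  rewrite -(fineK (fin_num_measure P _ (mA N))) -(fineK (fin_num_measure P _ mS)).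
  set p := fine _; set q := fine _; rewrite -EFinM !lee_fin lte_fin => pq aq.
  suff : q <= eps / 2 by lra.
  have -> : eps / 2 = a^-1 by rewrite /a invf_div.
  by rewrite -[leRHS]mul1r ler_pdivlMr// mulrC.
(* If [s (x, Q)] is at most [a] for one admissible [Q], then [s (x, P)] is infinite for every
   admissible [P]. *)
have cover x : A N1 x \/ A N2 x.
  case: (pselect (A N1 x)) => [|nA]; [by left|right=> Q CQ aQ].
  rewrite ltNge; apply/negP => sQ; apply: nA => P CP aP.
  by case: (sep P Q CP CQ aP aQ x) sQ => ->; rewrite ?ltry// leNgt ltry.
(* Closed balls are used so that their exterior [G], formed below, is open and still covers the
   space together with [A N1]. *)
pose inA b := forall x, mdist x (center b) <= radius b -> A N1 x.
have A_in x : A N1 x -> exists2 b, inA b & mdist x (center b) < radius b.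
  move=> Ax; have : nbhs (x : X) (A N1) by exact: open_nbhs_nbhs.
  rewrite -nbhs_ballE => -[e /= e0']; rewrite ballEmdist => eA.
  have e20 : 0 < e / 2 by rewrite divr_gt0.
  have [n _ /(_ n (leqnn n)) /= ne] := near_infty_natSinv_lt (PosNum e20).
  have [b rb xb] := small_ball x n; exists b => // y yb; apply: eA => /=.
  have {ne} : radius b < e / 2 by rewrite rb.
  have := metric_triangle x (center b) y; rewrite (metric_sym (center b)); lra.
have [|U [L2 [UA CL2 HL2]]] := compact_charged dense_alpha (c := 1 - eps) (N := N2)
    cC (mA N1) A_in.
  move=> Q CQ aQ; have := PA N2 Q CQ aQ.
  have : (1 <= Q (A N1) + Q (A N2))%E.
    rewrite -(probability_setT Q); apply: le_trans (measureU2 _ _ _) => //.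
    apply: le_measure; rewrite ?inE//; first exact: measurableU.
    by move=> x _; exact: cover.
  rewrite -(fineK (fin_num_measure Q _ (mA N1))).
  by rewrite -(fineK (fin_num_measure Q _ (mA N2))) -EFinD !lte_fin lee_fin; lra.
(* A point outside [G] lies in a closed ball of [U], hence in [A N1]; so [G] has nearly full measure
   where [N1] is avoided. *)
pose G : set (borel X) :=
  \bigcap_(a in [set` U]) [set x : X | radius a < mdist x (center a)].
have mG : measurable G.
  apply: fin_bigcap_measurable; first exact: finite_seq.
  by move=> b _; apply: open_measurable_borel; exact: open_mdist_gt.
pose phi b := {in U, forall a, apart alpha a b}.
have [||V [L1 [VU CL1 HL1]]] := compact_charged dense_alpha (c := 1 - eps) (N := N1)
    (phi := phi) cC mG.
- by move=> x Gx; exact: small_apart_ball.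
- move=> P CP aP; have := PA N1 P CP aP.
  have : (1 <= P G + P (A N1))%E.
    rewrite -(probability_setT P); apply: le_trans (measureU2 _ _ _) => //.
    apply: le_measure; rewrite ?inE//; first exact: measurableU.
    move=> x _; case: (pselect (G x)) => [|nG]; [by left|right].
    have [b [bU /negP]] : exists b, b \in U /\ ~ (radius b < mdist x (center b)).
      apply/not_existsP => h; apply: nG => b bU /=; apply/negP => nb.
      by apply: (h b); split=> //; exact/negP.
    by rewrite -leNgt; exact: UA.
  rewrite -(fineK (fin_num_measure P _ mG)).
  by rewrite -(fineK (fin_num_measure P _ (mA N1))) -EFinD !lte_fin lee_fin; lra.
exists U, V, L1, L2; split=> // b d bU dV; exact: VU.
Qed.

End separation.

(** * Recursive approximations *)

Section computable_rational.
Context {R : realType}.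
Local Open Scope nat_scope.

Lemma computable_app4 F f g h k :
  computable (fun s => F (nth 0 s 0) (nth 0 s 1) (nth 0 s 2) (nth 0 s 3)) ->
  computable f -> computable g -> computable h -> computable k ->
  computable (fun s => F (f s) (g s) (h s) (k s)).
Proof.
move=> rF rf rg rh rk.
apply: (computable_comp (gs := [:: f; g; h; k]) rF) => -[|[|[|[|[|i]]]]] //=;
  exact: computable_zero.
Qed.

Lemma computable_mem (l : seq nat) f : computable f ->
  computable (fun s => f s \in l).
Proof.
move=> rf; elim: l => [|a l IH]; first exact: computable_const.
have := computable_or (computable_eqn rf (computable_const a)) IH.
by apply: eq_computable => s; rewrite inE.
Qed.

(** Here and in the next three lemmas denominators are cleared and negative terms change sides,
    which turns a comparison of rationals into one of naturals. *)
Lemma rational_ltE (k n : nat) :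
  (Defs.rational k < n%:R :> R)%R = (entry k 0 < n * (entry k 2).+1 + entry k 1).
Proof.
by rewrite /Defs.rational ltr_pdivrMr ?ltr0n// ltrBlDr -natrM -natrD ltr_nat.
Qed.

Lemma pos_rational_ltE (p q k m : nat) :
  (pos_rational p + pos_rational q + 2^-1 ^+ k < Defs.rational m :> R)%R =
  ((((entry p 0).+1 * (entry q 1).+1 + (entry q 0).+1 * (entry p 1).+1) * 2 ^ k
     + (entry p 1).+1 * (entry q 1).+1) * (entry m 2).+1
   + entry m 1 * ((entry p 1).+1 * (entry q 1).+1 * 2 ^ k) <
   entry m 0 * ((entry p 1).+1 * (entry q 1).+1 * 2 ^ k)).
Proof.
rewrite /Defs.rational /pos_rational -(ltr_nat R) -[LHS]subr_gt0 -[RHS]subr_gt0.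
rewrite !(natrD, natrM) !natrX.
set a := (entry p 0).+1%:R; set b := (entry p 1).+1%:R.
set c := (entry q 0).+1%:R; set d := (entry q 1).+1%:R.
set e : R := (2 ^+ k)%R; set h := (entry m 2).+1%:R.
have [b0 d0 h0] : [/\ (0 < b :> R)%R, (0 < d :> R)%R & (0 < h :> R)%R].
  by rewrite !ltr0n.
have e0 : (0 < e)%R by rewrite exprn_gt0.
rewrite exprVn -/e -[RHS](pmulr_lgt0 _ (_ : (0 < (b * d * e * h)^-1)%R)); last first.
  by rewrite invr_gt0 !mulr_gt0.
by congr (0 < _)%R; field; rewrite !gt_eqF.
Qed.

Lemma rational_pos_rational_ltE (p q k m : nat) :
  (Defs.rational m + 2^-1 ^+ k + pos_rational p < pos_rational q :> R)%R =
  (entry m 0 * ((entry p 1).+1 * (entry q 1).+1 * 2 ^ k)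
   + ((entry p 1).+1 * (entry q 1).+1
      + (entry p 0).+1 * (entry q 1).+1 * 2 ^ k) * (entry m 2).+1 <
   entry m 1 * ((entry p 1).+1 * (entry q 1).+1 * 2 ^ k)
   + (entry q 0).+1 * (entry p 1).+1 * 2 ^ k * (entry m 2).+1).
Proof.
rewrite /Defs.rational /pos_rational -(ltr_nat R) -[LHS]subr_gt0 -[RHS]subr_gt0.
rewrite !(natrD, natrM) !natrX.
set a := (entry p 0).+1%:R; set b := (entry p 1).+1%:R.
set c := (entry q 0).+1%:R; set d := (entry q 1).+1%:R.
set e : R := (2 ^+ k)%R; set h := (entry m 2).+1%:R.
have [b0 d0 h0] : [/\ (0 < b :> R)%R, (0 < d :> R)%R & (0 < h :> R)%R].
  by rewrite !ltr0n.
have e0 : (0 < e)%R by rewrite exprn_gt0.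
rewrite exprVn -/e -[RHS](pmulr_lgt0 _ (_ : (0 < (b * d * e * h)^-1)%R)); last first.
  by rewrite invr_gt0 !mulr_gt0.
by congr (0 < _)%R; field; rewrite !gt_eqF.
Qed.

Lemma charge_ltE (n p T S : nat) :
  ((1 - 4^-1 ^+ n + pos_rational p) * T%:R < S%:R :> R)%R =
  ((4 ^ n * ((entry p 1).+1 + (entry p 0).+1)) * T <
   4 ^ n * (entry p 1).+1 * S + (entry p 1).+1 * T).
Proof.
rewrite /pos_rational -(ltr_nat R) -[LHS]subr_gt0 -[RHS]subr_gt0.
rewrite !(natrD, natrM) !natrX.
set a := (entry p 0).+1%:R; set b := (entry p 1).+1%:R.
set e : R := (4 ^+ n)%R.
have b0 : (0 < b :> R)%R by rewrite ltr0n.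
have e0 : (0 < e)%R by rewrite exprn_gt0.
rewrite exprVn -/e -[RHS](pmulr_lgt0 _ (_ : (0 < (b * e)^-1)%R)); last first.
  by rewrite invr_gt0 !mulr_gt0.
by congr (0 < _)%R; field; rewrite !gt_eqF.
Qed.

End computable_rational.

(** Higher-order patterns peel off one operation at a time; functions without a clause, such as
    [apart_at], are left as goals. *)
Ltac computability := repeat (cbv beta; lazymatch goal with
| |- computable (fun s => nth 0%N s _) => exact: computable_nth
| |- computable (fun s => nth 0%N (behead s) ?i) =>
    exact: (computable_behead (computable_nth i))
| |- computable (fun s => nth 0%N (behead (behead s)) ?i) =>
    exact: (computable_behead (computable_behead (computable_nth i)))
| |- computable (fun=> ?c) => exact: computable_const
| |- computable (fun s => (@?f s + @?g s)%N) => apply: (@computable_add f g)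
| |- computable (fun s => (@?f s * @?g s)%N) => apply: (@computable_mul f g)
| |- computable (fun s => (@?f s ^ @?g s)%N) => apply: (@computable_exp f g)
| |- computable (fun s => (@?f s).+1) => apply: (@computable_succ f)
| |- computable (fun s => entry (@?f s) (@?g s)) => apply: (@computable_entry f g)
| |- computable (fun s => nat_of_bool (@?b s && @?c s)) => apply: (@computable_and b c)
| |- computable (fun s => nat_of_bool (@?b s || @?c s)) => apply: (@computable_or b c)
| |- computable (fun s => nat_of_bool (@?f s == @?g s)) => apply: (@computable_eqn f g)
| |- computable (fun s => nat_of_bool ((@?f s).+1 <= @?g s)%N) =>
    apply: (@computable_ltn f g)
| |- computable (fun s => nat_of_bool (@?f s \in _)) => apply: (@computable_mem _ f)
| |- computable (fun s => nat_of_bool (all (@?b s) (CodeSeq.decode (@?h s)))) =>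
    apply: (@computable_all_decode b h)
| |- computable (fun s => nat_of_bool (has (@?b s) (CodeSeq.decode (@?h s)))) =>
    apply: (@computable_has_decode b h)
end).

Section approximation.
Context {R : realType} {X : completeMetricType R}.
Variable alpha : nat -> X.
Variable df : 3.-tuple nat -> nat.
Hypothesis df_recursive : recursive df.
Hypothesis df_dist : forall i j k : nat,
  `|mdist (alpha i) (alpha j) - Defs.rational (df [tuple i; j; k])| <= 2^-1 ^+ k.

Local Notation center b := (alpha (entry b 0)).
Local Notation radius b := (@pos_rational R (entry b 1)).
Local Notation mu := (rational_measure alpha).

Definition dist_index (i j k : nat) : nat := df [tuple i; j; k].

Lemma computable_dist_index f g h :
  computable f -> computable g -> computable h ->
  computable (fun s => dist_index (f s) (g s) (h s)).
Proof.
move=> rf rg rh n.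
have := @recursive_comp 3 n df (fun i t => nth (fun=> 0%N) [:: f; g; h] i t)
  df_recursive.
move=> /(_ _)/wrap[|].
  by case=> -[|[|[|i]]].
congr recursive; apply/funext => t; rewrite /dist_index; congr df.
by apply: val_inj; rewrite /= enum_ordSl enum_ordSl enum_ordSl enum_ord0.
Qed.

(* [apart_at k], [within_at k] and [charged_at k] use distances known up to
   [2^-k] only.  They imply the exact relations [apart], [inner] and [charged],
   and follow from them for all large [k], every inequality being strict. *)
Definition apart_at (k a b : nat) : bool :=
  radius a + radius b + 2^-1 ^+ k <
    Defs.rational (dist_index (entry a 0) (entry b 0) k).

Definition within_at (k i r b : nat) : bool :=
  Defs.rational (dist_index i (entry b 0) k) + 2^-1 ^+ k + @pos_rational R r < radius b.

(** A lower bound for the weight of [inner] in [charged]: a point counts only once approximate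
    distances place it inside. *)
Definition charge_at (k v b : nat) : nat :=
  weight (entry b 0)
    (fun i => has (within_at k i (entry b 1)) (CodeSeq.decode v)).

Definition charged_at (k n v b : nat) : bool :=
  (1 - 4^-1 ^+ n + radius b) * (weight (entry b 0) xpredT)%:R <
    (charge_at k v b)%:R.

Lemma computable_apart_at f g h :
  computable f -> computable g -> computable h ->
  computable (fun s => apart_at (f s) (g s) (h s)).
Proof.
apply: (@computable_app3 (fun k a b => apart_at k a b)).
rewrite /computable3 /apart_at.
apply: (eq_computable
  (fun s => congr1 nat_of_bool (esym (@pos_rational_ltE R _ _ _ _)))).
by computability; apply: computable_dist_index; computability.
Qed.

Lemma computable_within_at f g h k :
  computable f -> computable g -> computable h -> computable k ->
  computable (fun s => within_at (f s) (g s) (h s) (k s)).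
Proof.
apply: (@computable_app4 (fun k i r b => within_at k i r b)).
rewrite /within_at.
apply: (eq_computable
  (fun s => congr1 nat_of_bool (esym (@rational_pos_rational_ltE R _ _ _ _)))).
by computability; apply: computable_dist_index; computability.
Qed.

Lemma computable_charge_at f g h :
  computable f -> computable g -> computable h ->
  computable (fun s => charge_at (f s) (g s) (h s)).
Proof.
apply: (@computable_app3 charge_at).
rewrite /computable3 /charge_at /weight.
apply: (computable_sum_decode (G := fun s k => entry k 1 *
  has (within_at (nth 0 s 0) (entry k 0) (entry (nth 0 s 2) 1))
    (CodeSeq.decode (nth 0 s 1)))%N); computability.
by apply: computable_within_at; computability.
Qed.

Lemma computable_charged_at f g h k :
  computable f -> computable g -> computable h -> computable k ->
  computable (fun s => charged_at (f s) (g s) (h s) (k s)).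
Proof.
apply: (@computable_app4 (fun k n v b => charged_at k n v b)).
rewrite /charged_at.
apply: (eq_computable
  (fun s => congr1 nat_of_bool (esym (@charge_ltE R _ _ _ _)))).
computability; try by apply: computable_charge_at; computability.
- apply: (computable_sum_decode (G := fun s k => entry k 1 * true)%N);
  computability.
- apply: (computable_sum_decode (G := fun s k => entry k 1 * true)%N);
  computability.
Qed.

Lemma apart_at_sound k a b : apart_at k a b -> apart alpha a b.
Proof.
rewrite /apart_at /apart /dist_index.
have := df_dist (entry a 0) (entry b 0) k; rewrite ler_norml => /andP[h _].
set d := Defs.rational _ in h *; move: h; set e := _ ^+ k; lra.
Qed.

(** The factor two accounts for the error of the approximate distance and for the margin taken
    against that error. *)
Lemma near_exp (e : R) : 0 < e -> \forall k \near \oo, 2^-1 ^+ k *+ 2 < e.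
Proof.
move=> e0; have e20 : 0 < e / 2 by rewrite divr_gt0.
have := near_infty_natSinv_expn_lt (PosNum e20); apply: filterS => k /=.
rewrite div1r -exprVn => h.
suff key (u : R) : u < e / 2 -> u *+ 2 < e by exact: key.
by rewrite -(mulr_natr u); lra.
Qed.

Lemma near_apart_at a b : apart alpha a b -> \forall k \near \oo, apart_at k a b.
Proof.
rewrite /apart -subr_gt0 => /near_exp; apply: filterS => k.
have := df_dist (entry a 0) (entry b 0) k; rewrite ler_norml => /andP[_ h].
rewrite /apart_at /dist_index; move: h.
set d := Defs.rational _; set e := _ ^+ k; rewrite mulr2n; lra.
Qed.

Lemma within_at_inner k i b v : has (within_at k i (entry b 1)) (CodeSeq.decode v) ->
  inner alpha (CodeSeq.decode v) (radius b) (alpha i).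
Proof.
move=> /hasP[c cv]; rewrite /within_at /dist_index => ic; exists c => //.
have := df_dist i (entry c 0) k; rewrite ler_norml => /andP[_ h].
move: h ic; set d := Defs.rational _; set e := _ ^+ k; lra.
Qed.

Lemma near_within_at i b v :
  inner alpha (CodeSeq.decode v) (radius b) (alpha i) ->
  \forall k \near \oo, has (within_at k i (entry b 1)) (CodeSeq.decode v).
Proof.
move=> [c cv]; rewrite -subr_gt0 => /near_exp; apply: filterS => k h2.
apply/hasP; exists c => //; rewrite /within_at /dist_index.
have := df_dist i (entry c 0) k; rewrite ler_norml => /andP[h _].
move: h h2; set d := Defs.rational _; set e := _ ^+ k; rewrite mulr2n; lra.
Qed.

Lemma charged_at_sound k n v b : charged_at k n v b ->
  charged alpha (1 - 4^-1 ^+ n) (CodeSeq.decode v) b.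
Proof.
rewrite /charged_at /charged => /lt_le_trans; apply; rewrite ler_nat.
apply: weight_le => i h; apply/asboolP; exact: within_at_inner h.
Qed.

(** The centre has finite support, so one precision settles membership in [inner] for all of its
    points. *)
Lemma near_charged_at n v b :
  charged alpha (1 - 4^-1 ^+ n) (CodeSeq.decode v) b ->
  \forall k \near \oo, charged_at k n v b.
Proof.
rewrite /charged /charged_at => cb.
have : \forall k \near \oo, forall j, j \in CodeSeq.decode (entry b 0) ->
    `[< inner alpha (CodeSeq.decode v) (radius b) (alpha (entry j 0)) >] ->
    has (within_at k (entry j 0) (entry b 1)) (CodeSeq.decode v).
  apply: near_seq => j _.
  case: (boolP `[< _ >]) => [/asboolP/near_within_at|_]; last exact: nearW.
  by apply: filterS => k.
apply: filterS => k H; apply: lt_le_trans cb _; rewrite ler_nat.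
rewrite /charge_at /weight big_seq [leqRHS]big_seq; apply: leq_sum => j jb.
rewrite leq_mul2l; case: (boolP `[< _ >]) => [/(H j jb)->|_].
  by rewrite leqnn orbT.
by rewrite leq0n orbT.
Qed.

End approximation.

(** * The test attached to a sequence of certificates *)

Section certified_test.
Context {R : realType} {X : completeMetricType R}.
Variable alpha : nat -> X.
Variable df : 3.-tuple nat -> nat.
Hypothesis df_recursive : recursive df.
Hypothesis df_dist : forall i j k : nat,
  `|mdist (alpha i) (alpha j) - Defs.rational (df [tuple i; j; k])| <= 2^-1 ^+ k.
Hypothesis dense_alpha : dense (range alpha).

Local Notation center b := (alpha (entry b 0)).
Local Notation radius b := (@pos_rational R (entry b 1)).
Local Notation mu := (rational_measure alpha).

Variables v e K : nat -> nat.
Hypotheses (computable_v : computable1 v) (computable_e : computable1 e)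
  (computable_K : computable1 K).

(** An open set missing the balls of [V], given as a union of basic balls selected by a
    semidecidable condition. *)
Definition away (V : seq nat) : set (borel X) :=
  [set x | exists2 a, basic_ball alpha a x & {in V, forall b, apart alpha a b}].

(** A test must be normalized for every measure, not only on [C]; stage n therefore counts only in
    balls whose certificate is verified, at precision [K n]. *)
Definition certified (n : nat) : set (M X) :=
  \bigcup_(b in [set b | b \in CodeSeq.decode (e n) /\
    @charged_at R df (K n) n (v n) b]) basic_ball mu b.

Definition critical (n : nat) : set (X * M X) :=
  [set z | away (CodeSeq.decode (v n)) z.1 /\ certified n z.2].

(** Index 0 keeps the supremum away from the empty set. With a supremum, a strict lower bound is
    witnessed by a single stage. *)
Definition certified_test (z : X * M X) : \bar R :=
  ereal_sup [set n%:R%:E | n in [set n | n = 0%N \/ critical n z]].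

Lemma certified_test_ge0 z : (0 <= certified_test z)%E.
Proof. by apply: ereal_sup_ubound; exists 0%N => //; left. Qed.

Lemma certified_test_infinite z :
  (forall m, exists2 n, (m <= n)%N & critical n z) -> certified_test z = +oo%E.
Proof.
move=> H; apply/eqP; rewrite -leye_eq leye_eq; apply/eqP; apply/eqyP => a a0.
have [n an cn] := H (Num.truncn a).+1.
apply: (@le_trans _ _ n%:R%:E); last first.
  by apply: ereal_sup_ubound; exists n => //; right.
rewrite lee_fin ltW//; have /andP[_ /lt_le_trans] := truncn_itv (ltW a0).
by apply; rewrite ler_nat.
Qed.

Lemma away_not_inner (V : seq nat) x : away V x -> ~ inner alpha V 0 x.
Proof.
move=> [a]; rewrite /basic_ball ballEmdist /= => ax aV [b bV]; rewrite addr0 => xb.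
have := aV b bV; have := metric_triangle (center a) x (center b).
by rewrite /apart; lra.
Qed.

Lemma away_open V : open (away V : set X).
Proof.
have -> : (away V : set X) = \bigcup_(a in [set a | {in V, forall b, apart alpha a b}])
    basic_ball alpha a.
  by apply/seteqP; split=> x [a]; exists a.
apply: bigcup_open => a _; rewrite /basic_ball.
have -> : ball (center a) (radius a) = [set y : X | mdist y (center a) < radius a].
  by rewrite ballEmdist; apply/seteqP; split=> y /=; rewrite metric_sym.
exact: open_mdist_lt.
Qed.

Lemma certified_away n P : certified n P ->
  (P (away (CodeSeq.decode (v n))) <= (4^-1 ^+ n)%:E)%E.
Proof.
move=> [b [_ /charged_at_sound-/(_ X alpha df_dist)/charged_sound + bP]].
move=> /(_ _ bP); set V := CodeSeq.decode _.
have mA := open_measurable_borel (away_open V).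
have mI := open_measurable_borel (inner_open alpha V 0).
have : (P (away V) <= P (~` inner alpha V 0))%E.
  apply: le_measure; rewrite ?inE//; first exact: measurableC.
  exact: away_not_inner.
rewrite probability_setC// -(fineK (fin_num_measure P _ mA)).
rewrite -(fineK (fin_num_measure P _ mI)) -EFinB !lee_fin lte_fin; lra.
Qed.

Lemma certified_test_section_lsc P :
  lower_semicontinuous (fun x => certified_test (x, P)).
Proof.
move=> x r /ereal_sup_gt[_ [n On <-] rn].
case: On => [n0|[/= An Cn]].
  exists setT => [|y _]; first exact: filterT.
  by apply: (lt_le_trans rn); apply: ereal_sup_ubound; exists n => //; left.
exists (away (CodeSeq.decode (v n))) => [|y Ay].
  by apply: open_nbhs_nbhs; split=> //; exact: away_open.
by apply: (lt_le_trans rn); apply: ereal_sup_ubound; exists n => //; right.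
Qed.

(** The supremum is at most the sum of the n whose stage applies. Stage n has measure at most 4^-n,
    and n 4^-n is at most 2^-(n+1), with sum 1. *)
Lemma certified_test_normalized : normalized certified_test.
Proof.
move=> P.
pose D n : set (borel X) :=
  if `[< certified n P >] then away (CodeSeq.decode (v n)) else set0.
have mD n : measurable (D n).
  rewrite /D; case: ifP => // _; apply: open_measurable_borel; exact: away_open.
have PD n : (P (D n) <= (4^-1 ^+ n)%:E)%E.
  rewrite /D; case: (boolP `[< _ >]) => [/asboolP/certified_away//|_].
  by rewrite measure0 lee_fin exprn_ge0.
pose h n (x : borel X) : \bar R := (n%:R%:E * (\1_(D n) x)%:E)%E.
have h0 n x : (0 <= h n x)%E by rewrite mule_ge0// lee_fin.
have mh n : measurable_fun setT (h n).
  by apply: measurable_funeM; apply/measurable_EFinP; exact: measurable_indic.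
apply: (@le_trans _ _ (\int[P]_x (\sum_(0 <= n <oo) h n x))%E).
  apply: ge0_le_integral => //.
  - by move=> x _; exact: certified_test_ge0.
  - apply: lsc_measurable; exact: certified_test_section_lsc.
  - exact: (ge0_emeasurable_sum (P := xpredT) (fun n x _ _ => h0 n x)
      (fun n _ => mh n)).
  - move=> x _; apply: ge_ereal_sup => _ [n [->|[/= An Cn]] <-].
      exact: nneseries_ge0.
    apply: le_trans (nneseries_lim_ge n.+1 _) => //.
    rewrite big_nat_recr//= -[leLHS]add0e leeD//.
      by apply: sume_ge0.
    by rewrite /h /D asboolT// indicE mem_set// mule1.
rewrite integral_nneseries//.
apply: le_trans (@epsilon_trick0 R 1 xpredT ler01).
apply: lee_nneseries => [n _ _|n _].
  by apply: integral_ge0 => x _; exact: h0.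
rewrite ge0_integralZl//; last by apply/measurable_EFinP; exact: measurable_indic.
rewrite integral_indic// setIT.
apply: (@le_trans _ _ (n%:R%:E * (4^-1 ^+ n)%:E)%E).
  by apply: lee_wpmul2l => //; exact: PD.
rewrite -EFinM lee_fin exprVn ler_pdivrMr ?exprn_gt0// mulrC.
rewrite div1r ler_pdivlMr ?ltr0n ?expn_gt0// -natrX -natrM ler_nat.
elim: n => // n IH; rewrite !expnS in IH *.
have := ltn_expl n (ltnSn 1); have := expn_gt0 2 n.
have -> : (4 ^ n = 2 ^ n * 2 ^ n)%N by rewrite -expnMn.
nia.
Qed.

Lemma certified_test_lsc :
  lower_semicomputable alpha (rational_measure alpha) certified_test.
Proof.
(* The first argument codes a rational and two balls, the second a stage n and a precision j showing
   the first ball apart from those of [v n]. At stage 0 any two balls are accepted. *)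
pose b s := let k := entry (nth 0%N s 0) 0 in
  let a := entry (nth 0%N s 0) 1 in let c := entry (nth 0%N s 0) 2 in
  let n := entry (nth 0%N s 1) 0 in let j := entry (nth 0%N s 1) 1 in
  (entry k 0 < n * (entry k 2).+1 + entry k 1)%N &&
  ((n == 0%N) || (all (@apart_at R df j a) (CodeSeq.decode (v n)) &&
    has (fun d => (d == c) && @charged_at R df (K n) n (v n) d)
      (CodeSeq.decode (e n)))).
have rb : computable b.
  rewrite /b; computability.
  - apply: (computable_app1 computable_v); computability.
  - apply: computable_apart_at; computability.
    exact: df_recursive.
  - apply: (computable_app1 computable_e); computability.
  - apply: computable_charged_at; computability.
    + exact: df_recursive.
    + apply: (computable_app1 computable_K); computability.
    + apply: (computable_app1 computable_v); computability.
exists [set m | exists w, b [:: m; w]]; split; first exact: enumerable_exists.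
move=> k.
have bE c1 c2 w : b [:: CodeSeq.code [:: k; c1; c2]; w] =
  (Defs.rational k < (entry w 0)%:R :> R) &&
  ((entry w 0 == 0%N) ||
   (all (@apart_at R df (entry w 1) c1) (CodeSeq.decode (v (entry w 0))) &&
    has (fun d => (d == c2) && @charged_at R df (K (entry w 0)) (entry w 0)
      (v (entry w 0)) d) (CodeSeq.decode (e (entry w 0))))).
  by rewrite /b /= !entry_code /= rational_ltE.
apply/seteqP; split=> [[x P] /= kf|[x P] [[c1 c2] /= [w]]].
  have [_ [n On <-] kn] := ereal_sup_gt kf; rewrite lte_fin in kn.
  case: On => [n0|[[a /= ax aV] [c [ce cc] cP]]].
    (* At stage 0, balls of radius 1 containing [x] and [P] serve. *)
    have [a ra xa] := small_ball dense_alpha x 0.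
    have [m _ Pm] := prokhorov_dense dense_alpha P (ltr01 : 0 < 1 :> R).
    pose c := CodeSeq.code [:: m; CodeSeq.code [:: 0%N; 0%N]].
    exists (a, c) => /=; last first.
      split; first by rewrite /basic_ball ballEmdist /= metric_sym.
      rewrite /basic_ball ball_prokhorovE /= /c !entry_code /= prokhorov_sym.
      by rewrite /pos_rational !entry_code /= divr1.
    exists (CodeSeq.code [:: n; 0%N]).
    by rewrite bE !entry_code /= kn n0.
  have : \forall j \near \oo, forall d, d \in CodeSeq.decode (v n) ->
      @apart_at R df j a d.
    by apply: near_seq => d dv; apply: (near_apart_at df_dist); exact: aV.
  move=> [j _ /(_ j (leqnn j)) jV].
  exists (a, c) => //=; exists (CodeSeq.code [:: n; j]).
  rewrite bE !entry_code /= kn; apply/orP; right; apply/andP; split.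
    by apply/allP.
  by apply/hasP; exists c => //; rewrite eqxx.
rewrite bE => /andP[kw Hw] [/= xc1 Pc2].
apply: (@lt_le_trans _ _ (entry w 0)%:R%:E); first by rewrite lte_fin.
apply: ereal_sup_ubound; exists (entry w 0) => //=.
move: Hw => /orP[/eqP ->|/andP[/allP Ha /hasP[d de /andP[/eqP dc cd]]]].
  by left.
right; split=> /=.
  by exists c1 => // a' av; apply: (apart_at_sound df_dist); exact: Ha.
by exists d; rewrite ?dc// -dc.
Qed.

Lemma certified_test_uniform : uniform_test alpha certified_test.
Proof.
split; [exact: certified_test_ge0|exact: certified_test_lsc|].
exact: certified_test_normalized.
Qed.

End certified_test.

(** * Effective orthogonality *)

Section search.
Context {R : realType} {X : completeMetricType R}.
Variable alpha : nat -> X.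
Hypothesis dense_alpha : dense (range alpha).

Local Notation center b := (alpha (entry b 0)).
Local Notation radius b := (@pos_rational R (entry b 1)).
Local Notation mu := (rational_measure alpha).

(* If [x] is at distance at most [r] from the centre of a ball of [U] of radius
   [r], the balls of [V], being formally disjoint from that ball, do not
   contain [x] in their closure. *)
Lemma away_or (U V : seq nat) x : {in U & V, forall a b, apart alpha a b} ->
  away alpha U x \/ away alpha V x.
Proof.
move=> UV.
have awayI W : {in W, forall a, radius a < mdist x (center a)} -> away alpha W x.
  move=> /(small_apart_ball dense_alpha)[b Wb xb]; exists b.
    by rewrite /basic_ball ballEmdist /= metric_sym.
  by move=> a aW; rewrite apart_sym; exact: Wb.
case: (pselect {in U, forall a, radius a < mdist x (center a)}) => [/awayI|nU].
  by left.
right; apply: awayI => b bV; apply: contra_notT nU; rewrite -leNgt => xb a aU.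
have := UV a b aU bV; have := metric_triangle (center a) x (center b).
by rewrite /apart (metric_sym (center a) x); lra.
Qed.

(* [N1] and [N2] consist of the balls of a fine cover of [C] that miss [P],
   respectively [Q]. *)
Lemma separating_balls (C : set (M X)) (P Q : M X) : compact C -> ~ (P ≡μ Q) ->
  exists N1 N2 : seq nat, [/\ avoids alpha N1 P, avoids alpha N2 Q &
    forall P' Q', C P' -> C Q' -> avoids alpha N1 P' -> avoids alpha N2 Q' ->
      ~ (P' ≡μ Q')].
Proof.
move=> cC /prokhorov_gt0; set d := prokhorov P Q => d0.
have d40 : 0 < d / 4 by rewrite divr_gt0.
have [n _ /(_ n (leqnn n)) /= nd] := near_infty_natSinv_lt (PosNum d40).
pose D : set nat := [set b | radius b < d / 4].
move: cC; rewrite compact_cover => /(_ nat D (basic_ball mu)) [].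
- by move=> b _; exact: open_ball_prokhorov.
- move=> S CS; have n0 : 0 < n.+1%:R^-1 :> R by rewrite invr_gt0 ltr0n.
  have [m _ Sm] := prokhorov_dense dense_alpha S n0.
  pose b := CodeSeq.code [:: m; CodeSeq.code [:: 0%N; n]].
  have rb : radius b = n.+1%:R^-1 by rewrite /pos_rational !entry_code /= div1r.
  exists b; first by rewrite /D /= rb.
  by rewrite /basic_ball rb ball_prokhorovE /= entry_code /= prokhorov_sym.
move=> L LD CL.
pose N S := [seq b <- finmap.enum_fset L | `[< ~ basic_ball mu b S >]].
have avN S : avoids alpha (N S) S.
  by move=> b; rewrite mem_filter => /andP[/asboolP].
(* A ball of the cover containing [S'] is not in [N S], so it contains [S] too, and its radius is
   below d / 4. *)
have close S S' : C S' -> avoids alpha (N S) S' -> prokhorov S S' < d / 2.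
  move=> CS' aS'; have [b bL bS'] := CL S' CS'.
  have bS : basic_ball mu b S.
    apply/not_notP => nb; apply: (aS' b) => //.
    by rewrite mem_filter asboolT.
  have : radius b < d / 4 by have := LD b bL; rewrite inE.
  have := prokhorov_triangle S (mu (entry b 0)) S'.
  move: bS bS'; rewrite /basic_ball !ball_prokhorovE /= (prokhorov_sym _ S); lra.
exists (N P), (N Q); split=> // P' Q' CP' CQ' aP' aQ' PQ'.
have : prokhorov P' Q' <= 0.
  apply/ler_addgt0Pl => r r0; rewrite addr0; apply: prokhorov_le => // A mA.
  rewrite PQ'//; apply: (@le_trans _ _ (Q' (enlarge A r))).
    apply: le_measure; rewrite ?inE //; first exact: enlarge_measurable.
    by move=> x Ax; exists x; rewrite // mdistxx.
  by rewrite leeDl// lee_fin ltW.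
(* The distance d would be less than d / 2 + 0 + d / 2. *)
have := prokhorov_triangle P P' Q; have := prokhorov_triangle P' Q' Q.
have := close P P' CP' aP'; have := close Q Q' CQ' aQ'.
rewrite (prokhorov_sym Q Q') -/d; lra.
Qed.

Lemma computable_tuple1 (f : 1.-tuple nat -> nat) :
  recursive f -> computable1 (fun n => f [tuple n]).
Proof.
move=> rf n.
have := @recursive_comp 1 n f (fun i t => nth 0%N t 0) rf
  (fun i => computable_nth 0 n).
congr recursive; apply/funext => t; congr f.
by apply: val_inj; rewrite /= enum_ordSl enum_ord0.
Qed.

Variable df : 3.-tuple nat -> nat.
Hypothesis df_recursive : recursive df.
Hypothesis df_dist : forall i j k : nat,
  `|mdist (alpha i) (alpha j) - Defs.rational (df [tuple i; j; k])| <= 2^-1 ^+ k.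

(** At finite precision everything can be checked except that a list covers [C], so the covers are
    drawn from the enumeration [g]. The lists for eps = 4^-n make the search succeed at every n. *)
Lemma computable_search (C : set (M X)) (g : nat -> nat) (N1 N2 : seq nat) :
  computable1 g ->
  [set n | C `<=` \bigcup_(b in [set` CodeSeq.decode n]) basic_ball mu b] =
    range g ->
  (forall eps : R, 0 < eps -> exists U V L1 L2 : seq nat,
    [/\ {in U & V, forall a b, apart alpha a b},
    C `<=` \bigcup_(b in [set` L1]) basic_ball mu b,
    C `<=` \bigcup_(b in [set` L2]) basic_ball mu b,
    {in L1, forall b, b \notin N1 -> charged alpha (1 - eps) V b} &
    {in L2, forall b, b \notin N2 -> charged alpha (1 - eps) U b}]) ->
  exists u v e1 e2 K : nat -> nat,
    [/\ computable1 u, computable1 v, computable1 e1, computable1 e2 &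
        computable1 K] /\
    forall n, [/\ {in CodeSeq.decode (u n) & CodeSeq.decode (v n),
        forall a b, apart alpha a b},
      C `<=` \bigcup_(b in [set` CodeSeq.decode (e1 n)]) basic_ball mu b,
      C `<=` \bigcup_(b in [set` CodeSeq.decode (e2 n)]) basic_ball mu b,
      {in CodeSeq.decode (e1 n), forall b, b \notin N1 ->
        @charged_at R df (K n) n (v n) b} &
      {in CodeSeq.decode (e2 n), forall b, b \notin N2 ->
        @charged_at R df (K n) n (u n) b}].
Proof.
move=> rg gE lists.
(* A candidate [z] codes [U], [V], the places of two covers in the enumeration, and a precision;
   [N1] and [N2] are constants of the program. *)
pose S s := let z := nth 0%N s 0 in let n := nth 0%N s 1 in let k := entry z 4 in
  [&& all (fun a => all (fun b => @apart_at R df k a b)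
        (CodeSeq.decode (entry z 1))) (CodeSeq.decode (entry z 0)),
    all (fun b => (b \in N1) || @charged_at R df k n (entry z 1) b)
      (CodeSeq.decode (g (entry z 2))) &
    all (fun b => (b \in N2) || @charged_at R df k n (entry z 0) b)
      (CodeSeq.decode (g (entry z 3)))].
have rS : computable S.
  rewrite /S; computability.
  - by apply: (computable_apart_at df_recursive); computability.
  - by apply: (computable_app1 rg); computability.
  - by apply: (computable_charged_at df_recursive); computability.
  - by apply: (computable_app1 rg); computability.
  - by apply: (computable_charged_at df_recursive); computability.
have [s|h rh hS] := computable_min rS.
  set n := nth 0%N s 0.
  have [|U [V [L1 [L2 [UV CL1 CL2 HL1 HL2]]]]] := lists (4^-1 ^+ n).
    by rewrite exprn_gt0.
  have inE_g L : C `<=` \bigcup_(b in [set` L]) basic_ball mu b ->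
      exists i, g i = CodeSeq.code L.
    move=> CL; have : [set n | C `<=`
        \bigcup_(b in [set` CodeSeq.decode n]) basic_ball mu b] (CodeSeq.code L).
      by rewrite /= CodeSeq.codeK.
    by rewrite gE => -[i _]; exists i.
  have [i1 gi1] := inE_g L1 CL1; have [i2 gi2] := inE_g L2 CL2.
  have nearS (N L W : seq nat) :
      {in L, forall b, b \notin N -> charged alpha (1 - 4^-1 ^+ n) W b} ->
      \forall k \near \oo, forall b, b \in L ->
        (b \in N) || @charged_at R df k n (CodeSeq.code W) b.
    move=> HL; apply: near_seq => b bL.
    case: (boolP (b \in N)) => [_|bN]; first exact: nearW.
    apply: (near_charged_at df_dist); rewrite CodeSeq.codeK; exact: HL.
  have near_apart : \forall k \near \oo, forall a, a \in U -> forall b, b \in V ->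
      @apart_at R df k a b.
    apply: near_seq => a aU; apply: near_seq => b bV.
    by apply: (near_apart_at df_dist); exact: UV.
  have [k _ /(_ k (leqnn k)) /= [[kUV kL1] kL2]] :=
    filterI (filterI near_apart (nearS _ _ _ HL1)) (nearS _ _ _ HL2).
  exists (CodeSeq.code [:: CodeSeq.code U; CodeSeq.code V; i1; i2; k]).
  rewrite /S /= !entry_code /= gi1 gi2 !CodeSeq.codeK; apply/and3P; split.
  - by apply/allP => a aU; apply/allP => b; exact: kUV.
  - exact/allP.
  - exact/allP.
pose z n := h [:: n].
have rz : computable1 z.
  by apply: (computable_comp (gs := [:: fun s => nth 0%N s 0]) rh) => -[|[|i]];
    [exact: computable_nth|exact: computable_zero..].
have re i : computable1 (fun n => entry (z n) i).
  by apply: computable_entry rz (computable_const i).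
exists (fun n => entry (z n) 0), (fun n => entry (z n) 1),
  (fun n => g (entry (z n) 2)), (fun n => g (entry (z n) 3)),
  (fun n => entry (z n) 4); split.
  by split=> //; apply: (computable_app1 rg); exact: re.
move=> n; have := hS [:: n]; rewrite /S /= -/(z n).
move=> /and3P[/allP UV /allP HL1 /allP HL2].
have gC i : C `<=` \bigcup_(b in [set` CodeSeq.decode (g i)]) basic_ball mu b.
  have : range g (g i) by exists i.
  by rewrite -gE.
split=> //.
- by move=> a b /UV/allP UVa /UVa; exact: (apart_at_sound df_dist).
- by move=> b /HL1; case: (b \in N1).
- by move=> b /HL2; case: (b \in N2).
Qed.

End search.

Theorem theorem28 (R : realType) (X : completeMetricType R) (alpha : nat -> X)
    (hX : constructive_metric alpha) (C : set (M X))
    (hC : effectively_compact (rational_measure alpha) C)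
    (hs : exists s : X * M X -> \bar R, separator C s /\ lower_semicontinuous s) :
  effectively_orthogonal alpha C.
Proof.
move: hX hC hs => [dense_alpha [df [df_recursive df_dist]]] [cC enumC].
move=> [s [[s_ge0 _ s_int s_sep] s_lsc]] t [_ t_max] P Q CP CQ PQ.
have [N1 [N2 [aP aQ NPQ]]] := separating_balls dense_alpha cC PQ.
have lists eps (eps0 : 0 < eps) := separated_lists s_ge0 s_lsc s_int dense_alpha
  cC eps0 (ex_intro2 _ _ P CP aP) (ex_intro2 _ _ Q CQ aQ)
  (fun P' Q' CP' CQ' aP' aQ' => s_sep P' Q' CP' CQ' (NPQ P' Q' CP' CQ' aP' aQ')).
have [g rg gE] : exists2 g : nat -> nat, computable1 g &
    [set n | C `<=` \bigcup_(b in [set` CodeSeq.decode n])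
      basic_ball (rational_measure alpha) b] = range g.
  (* The empty case is excluded, since [lists] provides a finite cover of [C]. *)
  case: enumC => [E0|[g [rg gE]]]; last first.
    by exists (fun n => g [tuple n]) => //; exact: computable_tuple1.
  have [_ [_ [L [_ [_ CL _ _ _]]]]] := lists 1 ltr01.
  suff : set0 (CodeSeq.code L) by [].
  by rewrite -E0 /= CodeSeq.codeK.
have [u [v [e1 [e2 [K [[ru rv re1 re2 rK] H]]]]]] :=
  computable_search df_recursive df_dist rg gE lists.
have random_test f z : uniform_test alpha f -> (t z < +oo -> f z < +oo)%E.
  move=> /t_max[c c0 fct] tz; apply: le_lt_trans (fct z) _.
  by apply: lte_mul_pinfty => //; rewrite lee_fin ltW.
apply/seteqP; split=> // x [xP xQ].
(* A ball of the n-th cover containing [S] is not in [N], so it is certified. Every n with [x] away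
   from the list [f n] then bounds the test from below, and finiteness leaves only boundedly many
   such n. *)
have bounded f e N S : C S -> avoids alpha N S ->
    (forall n, C `<=` \bigcup_(b in [set` CodeSeq.decode (e n)])
      basic_ball (rational_measure alpha) b) ->
    (forall n, {in CodeSeq.decode (e n), forall b, b \notin N ->
      @charged_at R df (K n) n (f n) b}) ->
    (certified_test (R := R) alpha df f e K (x, S) < +oo)%E ->
    exists m, forall n, (m <= n)%N -> ~ away alpha (CodeSeq.decode (f n)) x.
  move=> CS aS Ce He; apply: contraPP => /forallNP Hm.
  rewrite certified_test_infinite ?ltxx// => m.
  have /existsNP[n /not_implyP[mn /contrapT An]] := Hm m.
  exists n => //; split=> //=; have [b be bS] := Ce n S CS.
  exists b => //; split=> //; apply: He => //.
  by apply/negP => bN; exact: aS bN bS.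
have [|||m1 Hm1] := bounded v e1 N1 P CP aP.
- by move=> n; case: (H n).
- by move=> n; case: (H n).
- by apply: random_test xP; exact: certified_test_uniform.
have [|||m2 Hm2] := bounded u e2 N2 Q CQ aQ.
- by move=> n; case: (H n).
- by move=> n; case: (H n).
- by apply: random_test xQ; exact: certified_test_uniform.
(* Beyond both bounds [x] is away from neither list, against formal disjointness. *)
have [UV _ _ _ _] := H (maxn m1 m2).
case: (away_or dense_alpha x UV) => [|].
- by apply: Hm2; exact: leq_maxr.
- by apply: Hm1; exact: leq_maxl.
Qed.
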